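(* Let $\{\mathcal{K}_\tau^+\}_{\tau\ge 0}$ be a family of sets with $\mathcal{K}_\tau^+\subset W^{\mathrm{loc}}([\tau,+\infty))$ for each $\tau\ge 0$ and $\mathcal{K}_{\tau_0}^+\neq\emptyset$ for some $\tau_0\ge 0$. Assume that the following two conditions hold. (A1) There exist a translation uniform integrable (t.u.i.) in $L_1^{\mathrm{loc}}(\mathbb{R}_+)$ function $c_1:\mathbb{R}_+\to\mathbb{R}_+$ and a constant $\alpha_1>0$ such that for each $\tau\ge 0$, $y\in\mathcal{K}_\tau^+$, and $t_2\ge t_1\ge\tau$, $$\|y(t_2)\|_H^2-\|y(t_1)\|_H^2+\alpha_1\int_{t_1}^{t_2}\|y(t)\|_V^p\,dt\le\int_{t_1}^{t_2}c_1(t)\,dt.$$ (A2) There exist a t.u.i. in $L_1^{\mathrm{loc}}(\mathbb{R}_+)$ function $c_2:\mathbb{R}_+\to\mathbb{R}_+$ and a constant $\alpha_2>0$ such that for each $\tau\ge 0$, $y\in\mathcal{K}_\tau^+$, and $t_2\ge t_1\ge\tau$, $$\int_{t_1}^{t_2}\|y'(t)\|_{V^*}^q\,dt\le\alpha_2\int_{t_1}^{t_2}\|y(t)\|_V^p\,dt+\int_{t_1}^{t_2}c_2(t)\,dt.$$ Let $\mathcal{K}^+$ be the extended united trajectory space of the family $\{\mathcal{K}_\tau^+\}_{\tau\ge0}$, let $\mathbb{X}=\{y(0): y\in\mathcal{K}^+\}$ with the metric induced from $H$, and let $G:\mathbb{R}_+\times\mathbb{X}\to 2^{\mathbb{X}}$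 be the m-semiflow $$G(t,y_0)=\{y(t): y(\cdot)\in\mathcal{K}^+,\ y(0)=y_0\},\qquad t\ge 0,\ y_0\in\mathbb{X}.$$ Then the m-semiflow $G$ has a compact global attractor $\Re$ in the phase space $\mathbb{X}$.
   Context: Setting. $\mathbb{R}_+=[0,+\infty)$. Let $p\ge 2$ and $q>1$ with $\frac1p+\frac1q=1$. Let $(V;H;V^* )$ be an evolution triple, in the usual sense: $V$ is a real separable reflexive Banach space, $H$ is a real separable Hilbert space identified with its dual, and $V\subset H\subset V^*$ with continuous and dense embeddings. It is assumed that the embedding $V\subset H$ is compact. Function spaces. For $0\le t_1<t_2<+\infty$ let $$W_{t_1,t_2}=\{y\in L_p(t_1,t_2;V): y'\in L_q(t_1,t_2;V^* )\},$$ where $y'$ is the derivative in the sense of $V^*$-valued distributions, with norm $\|y\|_{W_{t_1,t_2}}=\|y\|_{L_p(t_1,t_2;V)}+\|y'\|_{L_q(t_1,t_2;V^* )}$. One has $W_{t_1,t_2}\subset C([t_1,t_2];H)$ with continuous and dense embedding; elements are identified with their $H$-continuous representatives. For $\tau\ge0$, $$W^{\mathrm{loc}}([\tau,+\infty))=\{y:[\tau,+\infty)\to H:\ \Pi_{t_1,t_2}y\in W_{t_1,t_2}\text{ for each }[t_1,t_2]\subset[\tau,+\infty)\},$$ where $\Pi_{t_1,t_2}$ is the restriction to $[t_1,t_2]$. $C^{\mathrm{loc}}(\mathbb{R}_+;H)$ is the Fréchet space of continuous functions $\mathbb{R}_+\to H$ in which $f_n\to f$ iff $\Pi_{t_1,t_2}f_n\to\Pi_{t_1,t_2}f$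 in $C([t_1,t_2];H)$ for each finite interval $[t_1,t_2]\subset\mathbb{R}_+$. T.u.i. functions. A function $\varphi\in L_1^{\mathrm{loc}}(\mathbb{R}_+)$ is translation uniform integrable (t.u.i.) in $L_1^{\mathrm{loc}}(\mathbb{R}_+)$ if $$\lim_{K\to+\infty}\sup_{t\ge0}\int_t^{t+1}|\varphi(s)|\,\mathbf{I}\{|\varphi(s)|\ge K\}\,ds=0,$$ where $\mathbf{I}\{\cdot\}$ denotes the indicator. Trajectory spaces. For $y\in W^{\mathrm{loc}}(\mathbb{R}_+)$ and $h\ge0$, $T(h)y$ is the function $s\mapsto y(s+h)$ on $\mathbb{R}_+$. The united trajectory space is $$\mathcal{K}_\cup^+=\bigcup_{\tau\ge0}\{T(h)y(\cdot+\tau): y(\cdot)\in\mathcal{K}_\tau^+,\ h\ge0\}\subset W^{\mathrm{loc}}(\mathbb{R}_+),$$ and the extended united trajectory space $\mathcal{K}^+$ is the closure of $\mathcal{K}_\cup^+$ in $C^{\mathrm{loc}}(\mathbb{R}_+;H)$. The set $\mathbb{X}=\{y(0):y\in\mathcal{K}^+\}\subset H$ carries the metric $\rho_{\mathbb{X}}(x_1,x_2)=\|x_1-x_2\|_H$. Global attractor. For $D\subseteq\mathbb{X}$ put $G(t,D)=\bigcup_{y\in D}G(t,y)$. For nonempty $C,D\subseteq\mathbb{X}$, $\operatorname{dist}_{\mathbb{X}}(C,D)=\sup_{c\in C}\inf_{d\in D}\rho_{\mathbb{X}}(c,d)$. A set $\Re\subset\mathbb{X}$ is a global attractor of $G$ if: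 (i) $\Re$ attracts each bounded subset $B\subset\mathbb{X}$, i.e. $\operatorname{dist}_{\mathbb{X}}(G(t,B),\Re)\to0$ as $t\to+\infty$; (ii) $\Re$ is negatively semi-invariant, i.e. $\Re\subseteq G(t,\Re)$ for each $t\ge0$; (iii) $\Re$ is the minimal set among all nonempty closed subsets $C\subseteq\mathbb{X}$ that attract each bounded subset of $\mathbb{X}$ in the sense of (i). *)

(* Defs.v *)
From HB Require Import structures.
From mathcomp Require Import all_boot all_order all_algebra.
From mathcomp Require Import sesquilinear.
From mathcomp Require Import all_classical all_reals all_analysis.

Set Implicit Arguments.
Unset Strict Implicit.
Unset Printing Implicit Defensive.

Import Order.TTheory GRing.Theory Num.Theory.
Import numFieldNormedType.Exports.

Local Open Scope classical_set_scope.
Local Open Scope ring_scope.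

Section Dual.
Context (R : realType) (V : normedModType R).

Definition is_dual : {pred V -> R^o} :=
  fun f => `[< linear f /\ continuous f >].

Lemma is_dual_submod : submod_closed is_dual.
Proof.
split; first by apply/asboolP; split=> [a u v|x]; [rewrite scaler0 addr0|exact: cst_continuous].
move=> a f g /asboolP[lf cf] /asboolP[lg cg]; apply/asboolP; split.
  by move=> b u v; rewrite !fctE lf lg !scalerDr !scalerA (mulrC a) addrACA.
move=> x; apply: (@continuousD R R^o); last exact: cg.
by apply: (@continuousZr R R^o); exact: cf.
Qed.

HB.instance Definition _ := GRing.isSubmodClosed.Build R (V -> R^o) is_dual
  is_dual_submod.

Record dual := Dual { dual_fun :> V -> R^o ; dual_funP : dual_fun \in is_dual }.

HB.instance Definition _ := [isSub for dual_fun].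
HB.instance Definition _ := [Choice of dual by <:].
HB.instance Definition _ := [SubChoice_isSubLmodule of dual by <:].


Implicit Types f g : dual.

Lemma dual_linear f : linear f.
Proof. by have /asboolP[] := dual_funP f. Qed.

Lemma dual_continuous f : continuous f.
Proof. by have /asboolP[] := dual_funP f. Qed.

HB.instance Definition _ f :=
  GRing.isLinear.Build R V R^o *:%R (dual_fun f) (dual_linear f).

Definition dual_norm f : R :=
  sup [set `|f v| | v in [set v : V | `|v| <= 1]].

Lemma dual_norm_has_sup f : has_sup [set `|f v| | v in [set v : V | `|v| <= 1]].
Proof.
split; first by exists `|f 0|, 0 => //=; rewrite normr0.
have /bounded_funP/(_ 1)[M fM] :
    bounded_near (dual_fun f : {linear V -> R^o}) (nbhs (0 : V)).
  by apply: continuous_linear_bounded; exact: dual_continuous.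
by exists M => _ [v /= v1 <-]; exact: fM.
Qed.

Lemma dual_norm_ub f v : `|v| <= 1 -> `|f v| <= dual_norm f.
Proof. by move=> v1; apply: (sup_upper_bound (dual_norm_has_sup f)); exists v. Qed.

Lemma dual_norm_le f M :
  (forall v, `|v| <= 1 -> `|f v| <= M) -> dual_norm f <= M.
Proof.
by move=> fM; apply: ge_sup => [|_ [v v1 <-]]; [case: (dual_norm_has_sup f)|exact: fM].
Qed.

Lemma dual_normD f g : dual_norm (f + g) <= dual_norm f + dual_norm g.
Proof.
apply: dual_norm_le => v v1.
by apply: le_trans (ler_normD _ _) _; apply: lerD; exact: dual_norm_ub.
Qed.

Lemma dual_norm_ge0 f : 0 <= dual_norm f.
Proof. by apply: (le_trans _ (@dual_norm_ub f 0 _)); rewrite ?normr0. Qed.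

Lemma dual_normZ (a : R) f : dual_norm (a *: f) = `|a| * dual_norm f.
Proof.
have leZ b h : dual_norm (b *: h) <= `|b| * dual_norm h.
  apply: dual_norm_le => v v1.
  by rewrite [(b *: h) v]/(b * h v) normrM ler_wpM2l// dual_norm_ub.
apply/eqP; rewrite eq_le leZ /=.
have [->|a0] := eqVneq a 0; first by rewrite normr0 mul0r dual_norm_ge0.
rewrite -{1}(scale1r f) -(mulVf a0) -scalerA.
by rewrite -ler_pdivlMl ?normr_gt0// -normfV leZ.
Qed.

Lemma dual_norm0_eq0 f : dual_norm f = 0 -> f = 0.
Proof.
move=> f0; apply/val_inj/funext => v /=.
have [->|v0] := eqVneq v 0; first exact: linear0.
have : `|f (`|v|^-1 *: v)| <= 0.
  rewrite -f0; apply: dual_norm_ub.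
  by rewrite normrZ normfV normr_id mulVf// normr_eq0.
rewrite normr_le0 linearZ /= scaler_eq0 invr_eq0 normr_eq0 (negbTE v0) /=.
by move/eqP.
Qed.

HB.instance Definition _ := @Lmodule_isNormed.Build R dual dual_norm
  dual_normD dual_normZ dual_norm0_eq0.

End Dual.

Definition separable (T : topologicalType) :=
  exists D : set T, countable D /\ dense D.

Definition reflexive_space (R : realType) (V : normedModType R) :=
  forall F : dual (dual V), exists v : V, forall f : dual V, F f = f v.

Section Bochner.
Context (R : realType) (E : normedModType R).
Notation mu := (@lebesgue_measure R).
Implicit Types (D : set R) (s f : R -> E).

Definition simple_function s :=
  finite_set (range s) /\ forall x, measurable (s @^-1` [set x]).

(* Only meaningful for D of finite measure, where every simple function is
   integrable; below D is always a bounded interval. *)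
Definition simple_integral D s : E :=
  \sum_(x \in range s) fine (mu (D `&` s @^-1` [set x])) *: x.

Definition cvg_ae D (s_ : (R -> E)^nat) f :=
  {ae mu, forall t, D t -> s_ n t @[n --> \oo] --> f t}.

Definition strongly_measurable D f := exists s_ : (R -> E)^nat,
  (forall n, simple_function (s_ n)) /\ cvg_ae D s_ f.

Definition is_bochner_integral D f (x : E) := exists s_ : (R -> E)^nat,
  [/\ forall n, simple_function (s_ n),
      cvg_ae D s_ f,
      (\int[mu]_(t in D) `|f t - s_ n t|%:E @[n --> \oo] --> 0)%E &
      simple_integral D (s_ n) @[n --> \oo] --> x].

Definition memLp D (r : R) f := strongly_measurable D f /\
  (\int[mu]_(t in D) (`|f t| `^ r)%:E < +oo)%E.

End Bochner.

(* The identification of H with its dual is the map h |-> inner h, so that the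
   embedding of H into the dual of V sends h to v |-> (h, v)_H. *)
Record evolution_triple (R : realType) (V H : completeNormedModType R) :=
  EvolutionTriple {
    inner : {dot H for @idfun R} ;
    embVH : {linear V -> H} ;
    embHD : {linear H -> dual V} ;
    innerE : forall x, inner x x = `|x| ^+ 2 ;
    separableV : separable V ;
    reflexiveV : reflexive_space V ;
    separableH : separable H ;
    embVH_inj : injective embVH ;
    embVH_continuous : continuous embVH ;
    embVH_dense : dense (range embVH) ;
    embHDE : forall h v, embHD h v = inner h (embVH v) ;
    embHD_inj : injective embHD ;
    embHD_continuous : continuous embHD ;
    embHD_dense : dense (range embHD)
  }.

Definition compact_embedding (R : realType) (V H : completeNormedModType R)
    (T : evolution_triple V H) :=
  forall B : set V, bounded_set B -> precompact (embVH T @` B).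

Definition test_function (R : realType) (a b : R) (phi : R -> R) :=
  (forall n t, derivable (derive1n n phi) t 1) /\
  exists a' b', [/\ a < a', b' < b & forall t, ~ `[a', b']%classic t -> phi t = 0].

Section FunctionSpaces.
Context (R : realType) (V H : completeNormedModType R).
Context (T : evolution_triple V H) (p q : R).
Notation mu := (@lebesgue_measure R).
Implicit Types (y : R -> H) (g : R -> dual V).

(* The preimage under the embedding of V into H, and 0 outside its range. *)
Definition toV (h : H) : V := xget 0 [set v | embVH T v = h].

Definition memLpV (t1 t2 : R) y :=
  {ae mu, forall t, `[t1, t2]%classic t -> range (embVH T) (y t)} /\
  memLp `[t1, t2] p (toV \o y).

(* g is the derivative of y in the sense of V^*-valued distributions on
   ]t1, t2[. *)
Definition distr_derivative (t1 t2 : R) y g :=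
  forall phi, test_function t1 t2 phi -> exists x : dual V,
    is_bochner_integral `]t1, t2[ (fun t => derive1 phi t *: embHD T (y t)) x /\
    is_bochner_integral `]t1, t2[ (fun t => phi t *: g t) (- x).

Definition Lq_derivative (t1 t2 : R) y g :=
  memLp `[t1, t2] q g /\ distr_derivative t1 t2 y g.

(* Continuity selects the H-continuous representative. *)
Definition W (t1 t2 : R) : set (R -> H) := [set y |
  [/\ {within `[t1, t2], continuous y}, memLpV t1 t2 y &
      exists g, Lq_derivative t1 t2 y g]].

(* A function on [tau, +oo[ is represented by a total function on R whose
   values on ]-oo, tau[ are irrelevant. *)
Definition Wloc (tau : R) : set (R -> H) := [set y |
  forall t1 t2, tau <= t1 -> t1 < t2 -> W t1 t2 y].

Definition L1loc (c : R -> R) := measurable_fun `[0 : R, +oo[ c /\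
  forall t1 t2, 0 <= t1 -> t1 <= t2 -> mu.-integrable `[t1, t2] (EFin \o c).

Definition tail_sup (c : R -> R) (k : R) : \bar R := ereal_sup
  [set (\int[mu]_(s in `[t, (t + 1)%R])
          (`|c s| * \1_[set r | k <= `|c r|] s)%:E)%E | t in [set t : R | 0 <= t]].

Definition tui (c : R -> R) :=
  L1loc c /\ tail_sup c k @[k --> +oo] --> 0%E.

Variable K : R -> set (R -> H).

Definition condA1 := exists (c1 : R -> R) (alpha1 : R), [/\ tui c1,
  forall t : R, 0 <= t -> 0 <= c1 t, 0 < alpha1 &
  forall (tau : R) y (t1 t2 : R), 0 <= tau -> K tau y -> tau <= t1 -> t1 <= t2 ->
  ((`|y t2| ^+ 2 - `|y t1| ^+ 2)%:E +
     alpha1%:E * \int[mu]_(t in `[t1, t2]) (`|toV (y t)| `^ p)%:E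
   <= \int[mu]_(t in `[t1, t2]) (c1 t)%:E)%E].

(* The derivative y' is the a.e. unique g with Lq_derivative t1 t2 y g; it exists
   for y in Wloc tau, so that the quantification over g is not vacuous. *)
Definition condA2 := exists (c2 : R -> R) (alpha2 : R), [/\ tui c2,
  forall t : R, 0 <= t -> 0 <= c2 t, 0 < alpha2 &
  forall (tau : R) y (t1 t2 : R), 0 <= tau -> K tau y -> tau <= t1 -> t1 <= t2 ->
  forall g, Lq_derivative t1 t2 y g ->
  (\int[mu]_(t in `[t1, t2]) (`|g t| `^ q)%:E
   <= alpha2%:E * \int[mu]_(t in `[t1, t2]) (`|toV (y t)| `^ p)%:E
      + \int[mu]_(t in `[t1, t2]) (c2 t)%:E)%E].

End FunctionSpaces.

Section Trajectories.
Context (R : realType) (H : completeNormedModType R) (K : R -> set (R -> H)).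
Implicit Types (y : R -> H) (x : H).

Definition shift (h : R) y : R -> H := fun s => y (s + h).

Definition Kcup : set (R -> H) := [set z | exists tau h y,
  [/\ 0 <= tau, 0 <= h, K tau y & z = shift h (fun s => y (s + tau))]].

Definition segments : set (set R) := [set A | exists t1 t2,
  [/\ 0 <= t1, t1 <= t2 & A = `[t1, t2]%classic]].

(* The topology of C^loc(R_+; H) is uniform convergence on each segment of R_+;
   being oblivious to ]-oo, 0[, the closure contains all the extensions to R of
   a given function on R_+. *)
Definition Kplus : set (R -> H) := [set z |
  {within `[0 : R, +oo[, continuous z} /\
  closure (Kcup : set {family segments, R -> H}) z].

Definition phase_space : set H := [set y 0 | y in Kplus].

Definition semiflow (t : R) x : set H := [set y t | y in Kplus `&` [set y | y 0 = x]].

End Trajectories.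

Section Attractor.
Context (R : realType) (H : completeNormedModType R).
Variables (X : set H) (G : R -> H -> set H).
Implicit Types (A B C D : set H).

Definition semiflow_set (t : R) D : set H := \bigcup_(x in D) G t x.

Definition semidist C D : \bar R :=
  ereal_sup [set ereal_inf [set `|c - d|%:E | d in D] | c in C].

Definition attracts A := forall B, B `<=` X -> B !=set0 -> bounded_set B ->
  semidist (semiflow_set t B) A @[t --> +oo] --> 0%E.

Definition closed_attracting C :=
  [/\ C `<=` X, C !=set0, closed (C : set (subspace X)) & attracts C].

Definition global_attractor A := [/\ A `<=` X,
  attracts A,
  forall t, 0 <= t -> A `<=` semiflow_set t A &
  closed_attracting A /\ forall C, closed_attracting C -> A `<=` C].

End Attractor.

(* Main.v *)
Require Import Defs.
From mathcomp Require Import all_boot all_order all_algebra.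
From mathcomp Require Import finmap.
From mathcomp Require Import all_classical all_reals all_analysis.
From mathcomp Require Import measurable_realfun ring lra.

Set Implicit Arguments.
Unset Strict Implicit.
Unset Printing Implicit Defensive.

Import Order.TTheory GRing.Theory Num.Theory.
Import numFieldNormedType.Exports.

Local Open Scope classical_set_scope.
Local Open Scope ring_scope.

(** Let [z] be an element of the united trajectory space and [e s t] the energy
    [int_s^t ||z||_V^p].  Three facts about the pair [(z, e)] carry everything;
    they are collected in the record [controlled] and proved in
    [Kcup_controlled].  By (A1), [|z t|^2 - |z s|^2 + a1 e s t] is at most a
    modulus [d + k d (t - s)], where translation uniform integrability lets [d]
    be as small as desired, uniformly in the translation.  In every window there
    is a time at which [||z||_V^p] is close to its mean or below it.  By (A2) and
    Young's inequality, the pairing of an increment [z t - z s] with a vector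
    [v] of [V] is bounded by [(t - s) ||v||^p], the energy and the modulus.  The
    last fact requires recovering [z t - z s] from the distributional
    derivative: evaluated at [v], the defining identity of Bochner integrals
    becomes one of Lebesgue integrals, which is tested with smooth plateau
    functions exhausting the interval ([increment_pairing_le]).

    Dissipativity: in a unit of time either the energy is large and [|z|^2]
    drops by at least 1, or the window contains a time with a small [V]-norm and
    then [|z|^2] is bounded ([norm_bounds]).

    Compactness: if [z s = v] lies in [V], expanding [|z t - z s|^2] and using
    the bounds on [|z t|^2 - |z s|^2] and on the pairing with [v] shows that
    [|z t - z s|^2] is controlled by the energy of the window alone
    ([ctrl_strong]).  Take bounded trajectories indexed by a set with an
    ultrafilter, so that all bounded real quantities converge.  The limit energy
    is monotone in time, hence it is small on intervals just before a given time
    [t0]; since good times give compactness in [H], the trajectories are there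
    close to one fixed vector, thus to one fixed [v] of [V] by density.  Weak
    continuity against that [v] forbids [|z|^2] to drop by a fixed amount across
    [t0], so by (A1) no energy concentrates at [t0]
    ([no_energy_concentration]).  The energy of small windows around [t0] is
    then small, which yields equicontinuity at [t0] and relative compactness in
    [H] of the values, hence uniform convergence on segments of the open
    half-line ([ultra_uniform_limit]).

    The attractor is the set of limits of [z t] as [t] grows, for [z] starting
    in the absorbing ball.  Translating long trajectories to the left and taking
    a limit along an ultrafilter gives an element of the extended trajectory
    space whose values all lie in this set ([tail_limit]); compactness,
    attraction, negative semi-invariance and minimality all follow. *)

(** * Lower integrals and measurable representatives *)

Section LowerIntegral.
Context d (T : measurableType d) (R : realType).
Variable mu : {measure set T -> \bar R}.
Import HBNNSimple.
Local Open Scope ereal_scope.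

(** The integral of a nonnegative function is a supremum over simple functions
    below it, so it is monotone without any measurability: a simple function may
    be set to zero on a null set.  This matters because the norm of a strongly
    measurable function is only almost everywhere equal to a Borel function. *)
Lemma ae_ge0_le_lower_integral (D : set T) (f g : T -> \bar R) :
  (forall x, D x -> 0 <= f x) -> (forall x, D x -> 0 <= g x) ->
  {ae mu, forall x, D x -> f x <= g x} ->
  \int[mu]_(x in D) f x <= \int[mu]_(x in D) g x.
Proof.
move=> f0 g0 [N [mN muN fgN]].
rewrite ge0_integralE// ge0_integralE//.
apply: ge_ereal_sup => _ [h /= hf <-].
have mCN : measurable (~` N) by exact: measurableC.
apply: ereal_sup_ubound; exists (proj_nnsfun h mCN) => [x|].
  rewrite /= mindicE; have [xN|xN] := pselect (N x).
    rewrite (memNset (_ : ~ (~` N) x)) ?mulr0; last exact.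
    by rewrite /patch; case: ifPn => // /set_mem/g0.
  rewrite (mem_set (_ : (~` N) x)) ?mulr1//.
  apply: le_trans (hf x) _; rewrite /patch; case: ifPn => // /set_mem Dx.
  by apply: contrapT => nfg; apply: xN; apply: fgN => /= /(_ Dx).
rewrite -!integralT_nnsfun; apply: ge0_ae_eq_integral => //.
- exact/measurable_EFinP.
- exact/measurable_EFinP.
- by move=> x _; rewrite lee_fin.
- by move=> x _; rewrite lee_fin.
- exists N; split => // x /= nx; apply: contrapT => xN; apply: nx => _.
  by rewrite mindicE (mem_set (_ : (~` N) x)) ?mulr1.
Qed.

End LowerIntegral.

Section AeMeasurable.
Context (R : realType).
Notation mu := (@lebesgue_measure R).

Lemma ae_lim_measurable (D : set R) (g_ : (R -> R)^nat) (g : R -> R) :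
  measurable D -> (forall n, measurable_fun setT (g_ n)) ->
  {ae mu, forall t, D t -> g_ n t @[n --> \oo] --> g t} ->
  exists2 m : R -> R, measurable_fun setT m &
    {ae mu, forall t, D t -> m t = g t}.
Proof.
move=> mD mg [N [mN muN gN]].
have mDN : measurable (D `\` N) by exact: measurableD.
exists (g \_ (D `\` N)).
  apply: (@measurable_fun_cvg _ _ _ setT (fun n => (g_ n \_ (D `\` N)))).
    by move=> n; apply/measurable_restrict => //; rewrite setTI; exact: measurable_funTS.
  move=> t _; rewrite /patch; case: ifPn => [/set_mem[Dt Nt]|_]; last exact: cvg_cst.
  by apply: contrapT => h; apply: Nt; apply: gN => /= /(_ Dt).
exists N; split => // t /= nt; apply: contrapT => Nt; apply: nt => Dt.
by rewrite patchT// inE.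
Qed.

(** A preimage is a finite union of level sets of [s]. *)
Lemma simple_function_comp (E : normedModType R) (s : R -> E) (G : E -> R) :
  simple_function s -> measurable_fun setT (G \o s).
Proof.
move=> [fs ms] _ Y mY; rewrite setTI comp_preimage.
have -> : s @^-1` (G @^-1` Y) = \bigcup_(x in range s `&` (G @^-1` Y)) (s @^-1` [set x]).
  rewrite predeqE => t; split => [Yt|[x [_ Yx]] /= ->//].
  by exists (s t) => //; split => //; exists t.
by apply: fin_bigcup_measurable => [|x _]; [exact: finite_setIl|exact: ms].
Qed.

Lemma strongly_measurable_norm (E : normedModType R) (D : set R) (f : R -> E) :
  measurable D -> strongly_measurable D f ->
  exists2 m : R -> R, measurable_fun setT m &
    {ae mu, forall t, D t -> m t = `|f t|}.
Proof.
move=> mD [s [ss sf]].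
apply: (@ae_lim_measurable D (fun n t => `|s n t|)) => //.
  by move=> n; apply: (@simple_function_comp _ (s n) Num.norm).
move: sf; apply: (@filterS _ _ (ae_filter_ringOfSetsType _)) => t + Dt => /(_ Dt); exact: cvg_norm.
Qed.

End AeMeasurable.

Instance lebesgue_ae_filter (R : realType) :
  Filter (nbhs (almost_everywhere (@lebesgue_measure R))) :=
  ae_filter_ringOfSetsType _.

(** * The energy of a trajectory *)

Section Energy.
Context (R : realType) (E : normedModType R) (p : R).
Notation mu := (@lebesgue_measure R).
Implicit Types (f : R -> E).
Local Open Scope ereal_scope.

Lemma lebesgue_measure_segment (a b : R) : (a <= b)%R ->
  mu `[a, b]%classic = (b - a)%:E.
Proof. by move=> ab; rewrite lebesgue_measure_itv/= lte_fin; case: ltgtP ab => // -> _; rewrite subrr. Qed.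

(** Lower integrals are not additive in general; here the integrand has a Borel
    representative. *)
Lemma integral_powR_norm_split f (a s b : R) : (a <= s)%R -> (s <= b)%R ->
  strongly_measurable `[a, b] f ->
  \int[mu]_(t in `[a, b]) (`|f t| `^ p)%:E =
  \int[mu]_(t in `[a, s]) (`|f t| `^ p)%:E + \int[mu]_(t in `[s, b]) (`|f t| `^ p)%:E.
Proof.
move=> as_ sb /strongly_measurable_norm[|m mm mf]; first exact: measurable_itv.
pose M t : \bar R := (m t `^ p)%:E.
have M0 t : 0 <= M t by rewrite lee_fin powR_ge0.
have mM : measurable_fun setT M.
  by apply/measurable_EFinP; exact: (measurableT_comp (measurable_powR p) mm).
have eqM (D : set R) : measurable D -> D `<=` `[a, b] ->
    \int[mu]_(t in D) (`|f t| `^ p)%:E = \int[mu]_(t in D) M t.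
  move=> mD Dab; apply/eqP; rewrite eq_le; apply/andP; split;
    apply: ae_ge0_le_lower_integral => //;
    try (by move=> *; rewrite lee_fin powR_ge0);
    by move: mf; apply: filterS => t + Dt => /(_ (Dab _ Dt)) mft; rewrite /M mft.
rewrite !eqM//; last 2 first.
  - by apply: subset_itvr; rewrite bnd_simp.
  - by apply: subset_itvl; rewrite bnd_simp.
rewrite -(@integral_itv_bndo_bndc _ _ s); last exact: measurable_funTS.
rewrite -ge0_integral_setU//.
- congr (integral mu _ _); rewrite predeqE => t /=; rewrite !in_itv/=; split.
    by move=> /andP[-> ->]; case: (ltP t s) => ts; [left|right]; rewrite ?andbT.
  by move=> [|] /andP[] /= h1 h2; apply/andP; split;
    [|exact: ltW (lt_le_trans h2 sb)|exact: le_trans h1|].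
- exact: measurable_funTS.
- rewrite disj_set2E; apply/eqP; rewrite -subset0 => t /= [].
  by rewrite !in_itv/= => /andP[_ ts] /andP[st _]; move: (lt_le_trans ts st); rewrite ltxx.
Qed.

Lemma integral_cst_segment (k a b : R) : (a <= b)%R ->
  \int[mu]_(t in `[a, b]) k%:E = (k * (b - a))%:E.
Proof. by move=> ab; rewrite integral_cst//=; have -> := lebesgue_measure_segment ab. Qed.

End Energy.

Section EnergyV.
Context (R : realType) (V H : completeNormedModType R).
Context (T : evolution_triple V H) (p : R).
Notation mu := (@lebesgue_measure R).
Implicit Types (y : R -> H).

Definition energy y (s t : R) : R :=
  fine (\int[mu]_(r in `[s, t]) (`|toV T (y r)| `^ p)%:E)%E.

Lemma toVK h : range (embVH T) h -> embVH T (toV T h) = h.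
Proof. by move=> [v _ vh]; rewrite /toV; case: xgetP => [w _ //|/(_ v)]. Qed.

Lemma energy_ge0 y s t : 0 <= energy y s t.
Proof. by rewrite fine_ge0// integral_ge0// => r _; rewrite lee_fin powR_ge0. Qed.

Lemma memLpV_integral_split y (a s b : R) : a <= s -> s <= b -> memLpV T p a b y ->
  (\int[mu]_(r in `[a, b]) (`|toV T (y r)| `^ p)%:E \is a fin_num)%E /\
  energy y a s + energy y s b = energy y a b.
Proof.
move=> as_ sb [_ [sm fy]]; have := integral_powR_norm_split p as_ sb sm.
pose I u v : \bar R := (\int[mu]_(r in `[u, v]) (`|toV T (y r)| `^ p)%:E)%E.
rewrite /energy -/(I a b) -/(I a s) -/(I s b) => XYZ.
have I0 u v : (0 <= I u v)%E by apply: integral_ge0 => r _; rewrite lee_fin powR_ge0.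
have Xf : I a b \is a fin_num by rewrite ge0_fin_numE.
have Yf : I a s \is a fin_num.
  by rewrite ge0_fin_numE//; apply: le_lt_trans fy; rewrite -/(I a b) XYZ leeDl.
have Zf : I s b \is a fin_num.
  by rewrite ge0_fin_numE//; apply: le_lt_trans fy; rewrite -/(I a b) XYZ leeDr.
by split; [exact: Xf|rewrite XYZ; symmetry; exact: fineD].
Qed.

Lemma energyE y a b : a < b -> memLpV T p a b y ->
  (\int[mu]_(r in `[a, b]) (`|toV T (y r)| `^ p)%:E = (energy y a b)%:E)%E.
Proof.
by move=> ab my; have [? _] := memLpV_integral_split (lexx a) (ltW ab) my; rewrite fineK.
Qed.

(** Otherwise the integrand would exceed [k] almost everywhere, hence its
    integral [k * (b - a)]. *)
Lemma energy_small_point y (a b k : R) : a < b -> memLpV T p a b y ->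
  energy y a b < k * (b - a) ->
  exists s v, [/\ a <= s, s <= b, embVH T v = y s & `|v| `^ p <= k].
Proof.
move=> ab my ek; apply: contrapT => nex.
have k0 : 0 <= k.
  have := le_lt_trans (energy_ge0 y a b) ek.
  by rewrite pmulr_lgt0 ?subr_gt0// => /ltW.
suff : ((k * (b - a))%:E <= (energy y a b)%:E)%E by rewrite lee_fin leNgt ek.
rewrite -(integral_cst_segment k (ltW ab)) -energyE//.
apply: (@ae_ge0_le_lower_integral _ _ _ mu _ (fun=> k%:E)).
- by move=> *; rewrite lee_fin.
- by move=> *; rewrite lee_fin powR_ge0.
case: my => my _; move: my; apply: filterS => t + tab => /(_ tab) rt.
rewrite lee_fin leNgt; apply/negP => lek; apply: nex.
move: tab; rewrite /= in_itv/= => /andP[? ?].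
by exists t, (toV T (y t)); split => //; [exact: toVK|exact: ltW].
Qed.

End EnergyV.

(** * Translation uniform integrability *)

Section TranslationUniformIntegrability.
Context (R : realType).
Notation mu := (@lebesgue_measure R).

(** The values on the negative half-line are irrelevant; extending by zero makes
    the function measurable on the whole line. *)
Lemma tail_sup_restrict (c : R -> R) k :
  tail_sup c k = tail_sup (c \_ `[0, +oo[) k.
Proof.
rewrite /tail_sup; congr (ereal_sup _); apply: eq_imagel => t /= t0.
apply: eq_integral => s /set_mem/=; rewrite in_itv/= => /andP[ts _].
have s0 : 0 <= s by exact: le_trans t0 ts.
have cE : (c \_ `[0, +oo[) s = c s by rewrite patchT// inE/= in_itv/= s0.
by rewrite cE; congr (_ * _)%:E; rewrite !indicE; congr ((nat_of_bool _)%:R);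
  apply/idP/idP => /set_mem/=; rewrite ?cE => h; apply/mem_set => /=; rewrite ?cE.
Qed.

(** Split the integrand at the level [k] for which the tails have mass at most
    [d]: below it the integral is at most [k * (t - s)], uniformly in [s]. *)
Lemma tui_integral_segment (c : R -> R) : tui c -> (forall t, 0 <= t -> 0 <= c t) ->
  forall d, 0 < d -> exists2 k, 0 <= k & forall s t, 0 <= s -> s <= t -> t <= s + 1 ->
  (\int[mu]_(r in `[s, t]) (c r)%:E <= (d + k * (t - s))%:E)%E.
Proof.
move=> [[mc _] tailc] c0 d d0.
have : \forall k \near +oo, (tail_sup c k < d%:E)%E.
  apply: (tailc [set x | (x < d%:E)%E]); exists d => // x /=.
  by rewrite sub0r normrN lte_fin; apply: le_lt_trans; exact: ler_norm.
move=> /filterI /(_ (nbhs_pinfty_ge (num_real 0))) /filter_ex [k [tailk k0]].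
exists k => // s t s0 st ts1.
pose c' := c \_ `[0, +oo[.
have mc' : measurable_fun setT c'.
  by rewrite /c'; apply/measurable_restrict => //; rewrite setTI.
have c'0 r : 0 <= c' r.
  by rewrite /c' /patch; case: ifPn => // /set_mem/=; rewrite in_itv/= andbT => /c0.
have -> : (\int[mu]_(r in `[s, t]) (c r)%:E = \int[mu]_(r in `[s, t]) (c' r)%:E)%E.
  apply: eq_integral => r /set_mem/=; rewrite in_itv/= => /andP[sr _].
  by rewrite /c' patchT// inE/= in_itv/= (le_trans s0 sr).
pose A := [set r | k <= `|c' r|].
have mA : measurable A.
  rewrite -[X in measurable X]setTI.
  have -> : A = (fun r => `|c' r|) @^-1` `[k, +oo[.
    by rewrite predeqE => r; rewrite /A /= in_itv/= andbT.
  apply: (measurableT_comp (@normr_measurable R setT) mc') => //.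
pose h r := (`|c' r| * \1_A r)%:E : \bar R.
have mh : measurable_fun setT h.
  apply/measurable_EFinP; apply: measurable_funM => //.
    exact: (measurableT_comp (@normr_measurable R setT) mc').
have h0 r : (0 <= h r)%E by rewrite lee_fin mulr_ge0.
have hle : (\int[mu]_(r in `[s, (s + 1)%R]) h r <= d%:E)%E.
  apply: ltW; apply: le_lt_trans tailk; rewrite tail_sup_restrict.
  by apply: ereal_sup_ubound; exists s.
apply: (@le_trans _ _ (\int[mu]_(r in `[s, t]) (h r + k%:E))%E).
  apply: ge0_le_integral => //.
  - by move=> r _; rewrite lee_fin.
  - by apply/measurable_EFinP; exact: measurable_funTS.
  - by apply: emeasurable_funD => //; exact: measurable_funTS.
  - move=> r _; rewrite /h -EFinD lee_fin indicE.
    have [rA|rA] := boolP (r \in A).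
      by rewrite mulr1 ger0_norm// lerDl.
    rewrite mulr0 add0r; move: rA; rewrite notin_setE => /negP.
    by rewrite -ltNge ger0_norm// => /ltW.
rewrite ge0_integralD//; last exact: measurable_funTS.
rewrite integral_cst_segment// EFinD leeD//.
apply: le_trans hle; apply: ge0_subset_integral => //.
  exact: measurable_funTS.
by apply: subset_itvl; rewrite bnd_simp.
Qed.

End TranslationUniformIntegrability.

(** * A smooth step function *)

Section SmoothFunctions.
Context (R : realType).
Implicit Types (f g : R -> R) (n k : nat).

(** Differentiability of order [n], with the derivatives existentially
    quantified: closure under products and compositions is then an induction
    that never computes an iterated derivative. *)
Fixpoint diff_upto n f : Prop :=
  if n is m.+1 then exists2 g : R -> R, (forall x : R, is_derive x 1 f (g x)) & diff_upto m g
  else True.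

Definition smooth f := forall n, diff_upto n f.

Lemma diff_uptoW n f : diff_upto n.+1 f -> diff_upto n f.
Proof. by elim: n f => // n IH f [g fg /IH gn]; exists g. Qed.

Lemma diff_uptoD n f g : diff_upto n f -> diff_upto n g -> diff_upto n (f \+ g).
Proof.
elim: n f g => // n IH f g [f' ff' f'n] [g' gg' g'n].
by exists (f' \+ g'); [move=> x; exact: (is_deriveD (ff' x) (gg' x))|exact: IH].
Qed.

Lemma diff_uptoM n f g : diff_upto n f -> diff_upto n g -> diff_upto n (f \* g).
Proof.
elim: n f g => // n IH f g /[dup] fn [f' ff' f'n] /[dup] gn [g' gg' g'n].
exists ((f \* g') \+ (g \* f')); first by move=> x; exact: (is_deriveM (ff' x) (gg' x)).
by apply: diff_uptoD; apply: IH => //; exact: diff_uptoW.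
Qed.

Lemma diff_upto_cst n (c : R) : diff_upto n (cst c).
Proof. by elim: n c => // n IH c; exists (cst 0) => [x|]; [exact: is_derive_cst|exact: IH]. Qed.

Lemma diff_upto_id n : diff_upto n id.
Proof. by case: n => // n; exists (cst 1) => [x|]; [exact: is_derive_id|exact: diff_upto_cst]. Qed.

Lemma diff_upto_comp n f g : diff_upto n f -> diff_upto n g -> diff_upto n (f \o g).
Proof.
elim: n f g => // n IH f g [f' ff' f'n] /[dup] gn [g' gg' g'n].
exists ((f' \o g) \* g'); first by move=> x; exact: (is_derive1_comp (ff' _) (gg' x)).
by apply: diff_uptoM => //; apply: IH => //; exact: diff_uptoW.
Qed.

Lemma smoothD f g : smooth f -> smooth g -> smooth (f \+ g).
Proof. by move=> sf sg n; exact: diff_uptoD. Qed.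

Lemma smooth_comp f g : smooth f -> smooth g -> smooth (f \o g).
Proof. by move=> sf sg n; exact: diff_upto_comp. Qed.

Lemma smooth_affine (a b : R) : smooth (fun x => a * x + b).
Proof.
move=> n; apply: (@diff_uptoD _ (fun x => a * x) (cst b)); last exact: diff_upto_cst.
by apply: (@diff_uptoM _ (cst a) id); [exact: diff_upto_cst|exact: diff_upto_id].
Qed.

Lemma smooth_derivable f n t : smooth f -> derivable (derive1n n f) t 1.
Proof.
move=> sf; have : diff_upto 1 (derive1n n f).
  move: (sf n.+1); elim: n f {sf} => // n IH f [g fg gn].
  rewrite derive1Sn; suff -> : derive1 f = g by exact: IH.
  by apply/funext => x; rewrite derive1E derive_val.
by case=> g fg _; exact: ex_derive.
Qed.

Lemma smooth_derive f : smooth f -> smooth (derive1 f).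
Proof.
move=> sf n; have [g fg gn] := sf n.+1; suff -> : derive1 f = g by [].
by apply/funext => x; rewrite derive1E derive_val.
Qed.

Lemma smooth_continuous f : smooth f -> continuous f.
Proof.
move=> sf x; apply/differentiable_continuous/derivable1_diffP.
exact: (@smooth_derivable f 0%N x sf).
Qed.

Lemma smooth_is_derive f (t : R) : smooth f -> is_derive t 1 f (derive1 f t).
Proof.
move=> sf; rewrite derive1E; apply: derivableP.
exact: (@smooth_derivable f 0%N t sf).
Qed.

Lemma smooth_cst (c : R) : smooth (cst c).
Proof. by move=> n; exact: diff_upto_cst. Qed.

Lemma smoothM f g : smooth f -> smooth g -> smooth (f \* g).
Proof. by move=> sf sg n; exact: diff_uptoM. Qed.

Lemma derive1_smoothD f g t : smooth f -> smooth g ->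
  derive1 (f \+ g) t = derive1 f t + derive1 g t.
Proof.
move=> /(smooth_is_derive t) df /(smooth_is_derive t) dg.
have D : is_derive t 1 (f \+ g) (derive1 f t + derive1 g t) := is_deriveD df dg.
by rewrite [LHS]derive1E derive_val.
Qed.

Lemma derive1_smoothZ (c : R) f t : smooth f ->
  derive1 (cst c \* f) t = c * derive1 f t.
Proof.
move=> /(smooth_is_derive t) df.
have D : is_derive t 1 (cst c \* f) (c * derive1 f t + f t * 0) :=
  is_deriveM (is_derive_cst c t 1) df.
by rewrite [LHS]derive1E derive_val mulr0 addr0.
Qed.

Lemma derive1_smoothDcst f g (c : R) t : smooth f -> smooth g ->
  derive1 (fun t => f t + (g t + c)) t = derive1 f t + derive1 g t.
Proof.
move=> sf sg; have sc := smooth_cst c.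
rewrite (derive1_smoothD t sf (smoothD sg sc)) (derive1_smoothD t sg sc).
by rewrite derive1_cst addr0.
Qed.

Lemma derive1_smooth_combination (c d : R) f g t : smooth f -> smooth g ->
  derive1 ((cst c \* f) \+ (cst d \* g)) t = c * derive1 f t + d * derive1 g t.
Proof.
move=> sf sg; have sc := smooth_cst c; have sd := smooth_cst d.
rewrite (derive1_smoothD t (smoothM sc sf) (smoothM sd sg)).
by rewrite (derive1_smoothZ c t sf) (derive1_smoothZ d t sg).
Qed.

(** The functions [x^-k e^(-1/x)], extended by zero to the negative axis, form a
    family whose span is stable under derivation; smoothness at zero follows. *)
Definition flat k (x : R) : R := if 0 < x then x^-1 ^+ k * expR (- x^-1) else 0.

Lemma flat_ge0 k x : 0 <= flat k x.
Proof.
by rewrite /flat; case: ifP => // x0; rewrite mulr_ge0 ?expR_ge0// exprn_ge0// invr_ge0 ltW.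
Qed.

(** The exponential series dominates [y^(k+2) / (k+2)!] at [y = x^-1].  The
    quadratic decay makes the derivative at zero vanish. *)
Lemma flat_le k x : 0 <= x -> flat k x <= k.+2`!%:R * x ^+ 2.
Proof.
rewrite /flat; case: ifP => [x0 _|_ x0]; last by rewrite mulr_ge0// sqr_ge0.
have y0 : 0 <= x^-1 by rewrite invr_ge0 ltW.
have := expR_ge1Dxn k.+1 y0.
have f0 : 0 < k.+2`!%:R :> R by rewrite ltr0n fact_gt0.
move=> h; have le : x^-1 ^+ k.+2 * expR (- x^-1) <= k.+2`!%:R.
  rewrite expRN ler_pdivrMr ?expR_gt0// mulrC -ler_pdivrMr//.
  by apply: le_trans h; rewrite lerDr.
suff -> : x^-1 ^+ k * expR (- x^-1) = x^-1 ^+ k.+2 * expR (- x^-1) * x ^+ 2.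
  by rewrite ler_wpM2r// sqr_ge0.
by rewrite -addn2 exprD mulrAC -(mulrA (_ ^+ k)) -exprMn mulVf ?gt_eqF// expr1n mulr1.
Qed.

Lemma is_derive_flat k (x : R) :
  is_derive x 1 (flat k) (- k%:R * flat k.+1 x + flat k.+2 x).
Proof.
have [x0|x0|->] := ltgtP x 0.
- have -> : - k%:R * flat k.+1 x + flat k.+2 x = 0.
    by rewrite /flat ltNge (ltW x0)/= mulr0 addr0.
  apply: (@near_eq_is_derive R R R (cst 0)).
  by near=> z; rewrite /flat ltNge (ltW (_ : z < 0))//; near: z; exact: lt_nbhsl.
- apply: (@near_eq_is_derive R R R (fun z => z^-1 ^+ k * expR (- z^-1))).
    by near=> z; rewrite /flat (_ : 0 < z)//; near: z; exact: lt_nbhsr.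
  have xn0 : x != 0 by rewrite gt_eqF.
  have dV : is_derive x 1 (fun z : R => z^-1) (- x ^- 2).
    apply: is_derive_eq; first exact: (@is_deriveV _ id x 1 1 xn0 (is_derive_id _ _)).
    by rewrite /= scaler1.
  have dE : is_derive x 1 (expR \o (-%R \o (fun z : R => z^-1))) 
     (expR (- x^-1) * (-1 * (- x ^- 2))).
    by apply: is_derive1_comp; apply: is_derive1_comp.
  have dX := @is_deriveX _ _ (fun z : R => z^-1) k x 1 _ dV.
  have -> : (fun z : R => z^-1 ^+ k * expR (- z^-1)) =
      (fun z : R => z^-1) ^+ k * (expR \o (-%R \o (fun z : R => z^-1))).
    by apply/funext => z; rewrite !fctE.
  have dXE := is_deriveM dX dE; apply: (is_derive_eq dXE).
  rewrite /flat x0 /= /GRing.scale/= !fctE.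
  rewrite mulN1r opprK -!exprVn.
  clear dX dXE; case: k => [|k]; first by rewrite !expr0 !mul0r !oppr0 !mul0r; ring.
  by move: (expR _) => e; rewrite /= !exprS; ring.
- have d0 : h^-1 *: ((flat k \o shift 0) (h *: 1) - flat k 0) @[h --> 0^'] --> (0 : R).
    have F0 h : `|h^-1 *: ((flat k \o shift 0) (h *: 1) - flat k 0)| <= k.+2`!%:R * `|h|.
      rewrite /= addr0 [h *: 1]mulr1 {2}/flat ltxx subr0 normrM normfV.
      have [->|hn0] := eqVneq h 0; first by rewrite normr0 invr0 mul0r mulr0.
      rewrite ler_pdivrMl ?normr_gt0// mulrCA -expr2 real_normK ?num_real//.
      have [h0|h0] := leP 0 h; first by rewrite ger0_norm ?flat_ge0// flat_le.
      by rewrite /flat ltNge (ltW h0)/= normr0 mulr_ge0// sqr_ge0.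
    apply/cvgr0Pnorm_le => e e0; near=> h; apply: le_trans (F0 h) _.
    rewrite -ler_pdivlMl ?ltr0n ?fact_gt0//; near: h.
    apply: dnbhs0_le.
    by rewrite mulr_gt0// invr_gt0 ltr0n fact_gt0.
  have -> : - k%:R * flat k.+1 0 + flat k.+2 0 = 0 by rewrite /flat ltxx mulr0 addr0.
  apply: DeriveDef; first by apply/cvg_ex; exists 0.
  exact: cvg_lim d0.
Unshelve. all: by end_near. Qed.

Lemma smooth_flat k : smooth (flat k).
Proof.
move=> n; elim: n k => // n IH k.
exists (fun x => - k%:R * flat k.+1 x + flat k.+2 x); first exact: is_derive_flat.
apply: (@diff_uptoD _ (cst (- k%:R) \* flat k.+1) (flat k.+2)) => //.
by apply: diff_uptoM; [exact: diff_upto_cst|exact: IH].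
Qed.

(** For [x <= 0] the inner value [1 - e * flat 0 (1 - x)] is nonpositive since
    [flat 0 1 = e^-1]; for [1 <= x] it is [1], and [e * flat 0 1 = 1]. *)
Definition step (x : R) : R := expR 1 * flat 0 (1 - expR 1 * flat 0 (1 - x)).

Lemma smooth_step : smooth step.
Proof.
have aff (a b : R) f : smooth f -> smooth (fun x => a * f x + b).
  by move=> sf; apply: (@smooth_comp (fun x => a * x + b)) => //; exact: smooth_affine.
have -> : step = (fun x => expR 1 * x + 0) \o (flat 0 \o
    ((fun x => - expR 1 * x + 1) \o (flat 0 \o (fun x => -1 * x + 1)))).
  by apply/funext => x; rewrite /step/= addr0 mulN1r mulNr ![- _ + 1]addrC.
by do !(apply: smooth_comp; last first); do ?exact: smooth_flat; exact: smooth_affine.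
Qed.

Lemma step0 x : x <= 0 -> step x = 0.
Proof.
move=> x0; rewrite /step /flat !expr0 !mul1r.
rewrite [X in expR 1 * (if 0 < 1 - expR 1 * X then _ else _)]ifT; last first.
  by rewrite subr_gt0 (le_lt_trans x0).
rewrite ifF ?mulr0//; apply/negbTE; rewrite -leNgt subr_le0 -expRD -[leLHS]expR0 ler_expR.
by rewrite subr_ge0 invf_le1 ?lerBrDl ?gerDr// subr_gt0 (le_lt_trans x0).
Qed.

Lemma step1 x : 1 <= x -> step x = 1.
Proof.
move=> x1; rewrite /step {2}/flat ifF ?mulr0 ?subr0; last first.
  by apply/negbTE; rewrite -leNgt subr_le0.
by rewrite /flat ltr01 expr0 mul1r invr1 -expRD subrr expR0.
Qed.

Lemma step_ge0 x : 0 <= step x.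
Proof. by rewrite /step mulr_ge0 ?expR_ge0// flat_ge0. Qed.

Lemma step_le1 x : step x <= 1.
Proof.
rewrite /step; set u := 1 - _.
have u1 : u <= 1 by rewrite /u gerBl mulr_ge0 ?expR_ge0// flat_ge0.
rewrite /flat expr0 mul1r; case: ifP => [u0|_]; last by rewrite mulr0.
by rewrite -expRD expR_le1 subr_le0 invf_ge1.
Qed.

(** Only this existence statement is used below: the defining formula of [step]
    must not be unfolded. *)
Lemma exists_smooth_step : exists f : R -> R,
  [/\ smooth f, forall x, x <= 0 -> f x = 0, forall x, 1 <= x -> f x = 1,
      forall x, 0 <= f x & forall x, f x <= 1].
Proof.
exists step; split; [exact: smooth_step|exact: step0|exact: step1|..].
  exact: step_ge0.
exact: step_le1.
Qed.

End SmoothFunctions.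

(** * Evaluation of Bochner integrals of dual vectors *)

Section BochnerEval.
Context (R : realType) (V : completeNormedModType R).
Notation mu := (@lebesgue_measure R).
Implicit Types (D : set R) (s f : R -> dual V) (v : V).

Lemma dual_norm_eval (g : dual V) v : `|g v| <= `|g| * `|v|.
Proof.
have [->|v0] := eqVneq v 0; first by rewrite linear0 !normr0 mulr0.
have v0' : 0 < `|v| by rewrite normr_gt0.
rewrite -ler_pdivrMr// mulrC -[X in X * _](ger0_norm (_ : 0 <= `|v|^-1)) ?invr_ge0//.
rewrite -normrM.
have -> : `|v|^-1 * g v = g (`|v|^-1 *: v) by rewrite linearZ.
by apply: dual_norm_ub; rewrite normrZ normfV normr_id mulVf ?gt_eqF.
Qed.

Lemma dual_eval_sum (I : Type) (r : seq I) (F : I -> dual V) v :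
  (\sum_(i <- r) F i) v = \sum_(i <- r) F i v.
Proof. by elim: r => [|i r IH]; rewrite ?big_nil// !big_cons -IH. Qed.

(** Decompose [s t v] as the sum over the values [x] of [s] of [x v] times the
    indicator of a level set. *)
Lemma simple_integral_eval D s v : measurable D -> (mu D < +oo)%E ->
  simple_function s ->
  mu.-integrable D (fun t => (s t v)%:E) /\
  (\int[mu]_(t in D) (s t v)%:E = (simple_integral D s v)%:E)%E.
Proof.
move=> mD Doo [fs ms].
have sE t : (s t v)%:E =
    (\sum_(x <- fset_set (range s)) (x v)%:E * (\1_(s @^-1` [set x]) t)%:E)%E.
  rewrite (bigD1_seq (s t)) ?fset_uniq//=; last by rewrite in_fset_set// inE; exists t.
  rewrite indicE mem_set//= mule1 big1 ?adde0// => x xst.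
  by rewrite indicE memNset ?mule0//= => sx; move: xst; rewrite sx eqxx.
have muoo x : (mu (s @^-1` [set x] `&` D) < +oo)%E.
  apply: le_lt_trans Doo; apply: le_measure; rewrite ?inE//.
  by apply: measurableI => //; exact: ms.
have int1E x : (\int[mu]_(t in D) (\1_(s @^-1` [set x]) t)%:E =
    mu (s @^-1` [set x] `&` D))%E by rewrite integral_indic//; exact: ms.
have int1 x : mu.-integrable D (fun t => (\1_(s @^-1` [set x]) t)%:E).
  apply/integrableP; split.
    apply/measurable_EFinP. apply: measurable_indic. exact: (ms x).
  under eq_integral do rewrite gee0_abs ?lee_fin//.
  rewrite int1E. exact: muoo.
have inti (x : dual V) : mu.-integrable D (fun t => (x v)%:E * (\1_(s @^-1` [set x]) t)%:E)%E.
  apply: integrableZl; [exact: mD|exact: int1].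
split.
  rewrite (eq_fun sE); exact: integrable_sum.
under eq_integral do rewrite sE.
rewrite integral_sum// /simple_integral fsbig_finite// dual_eval_sum -sumEFin.
apply: eq_bigr => x _; rewrite integralZl//.
rewrite int1E setIC; have -> (a : R) : (a *: x) v = x v * a by rewrite mulrC.
rewrite EFinM fineK//.
by rewrite ge0_fin_numE// setIC.
Qed.

(** Reduces vector valued integrals to scalar ones.  Evaluation at [v] is
    Lipschitz, so the evaluated simple functions converge almost everywhere to a
    Borel function [h], and in mean; their integrals converge to [x v]. *)
Lemma bochner_integral_eval D f (x : dual V) v : measurable D -> (mu D < +oo)%E ->
  is_bochner_integral D f x -> exists h : R -> R,
  [/\ measurable_fun setT h, {ae mu, forall t, D t -> h t = f t v},
      mu.-integrable D (EFin \o h) & \int[mu]_(t in D) h t = x v].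
Proof.
move=> mD Doo [s [ss sf intfs six]].
have mD' : measurable (D : set (g_sigma_algebraType R.-ocitv.-measurable)) := mD.
have msv n : measurable_fun setT (fun t => s n t v).
  exact: (@simple_function_comp _ _ (s n) (fun g => g v)).
(* The added 1 keeps the Lipschitz constant invertible when [v = 0]. *)
pose c := `|v| + 1; have c0 : 0 < c by rewrite ltr_wpDl.
have evalB (g k : dual V) : `|g v - k v| <= c * `|g - k|.
  rewrite (_ : g v - k v = (g - k) v)//; apply: le_trans (dual_norm_eval _ _) _.
  by rewrite mulrC ler_wpM2r// lerDl.
have [|h mh hf] := ae_lim_measurable (g := fun t => f t v) mD msv.
  move: sf; apply: filterS => t + Dt => /(_ Dt) sft.
  apply/cvgrPdist_le => e e0.
  move/cvgrPdist_le : sft => /(_ (c^-1 * e)).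
  rewrite mulr_gt0 ?invr_gt0// => /(_ isT); apply: filterS => n.
  by rewrite ler_pdivlMl// => h; exact: le_trans (evalB _ _) h.
have intsv n := simple_integral_eval v mD Doo (ss n).
pose d n t := h t - s n t v.
have md n : measurable_fun setT (d n) by exact: measurable_funB.
have dle n : (\int[mu]_(t in D) `|(d n t)%:E| <=
    c%:E * \int[mu]_(t in D) `|f t - s n t|%:E)%E.
  rewrite -lee_pdivrMl// -ge0_integralZl//.
  - apply: ae_ge0_le_lower_integral => [t _|t _|].
    + by rewrite mule_ge0// lee_fin invr_ge0 ltW.
    + by rewrite lee_fin.
    + move: hf; apply: filterS => t + Dt => /(_ Dt) ht.
      by rewrite -EFinM lee_fin /d ht ler_pdivrMl.
  - by apply/measurable_funTS/measurable_EFinP; exact: (measurableT_comp (@normr_measurable R setT) (md n)).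
  - by rewrite lee_fin invr_ge0 ltW.
have small e : 0 < e -> \forall n \near \oo, (\int[mu]_(t in D) `|(d n t)%:E| <= e%:E)%E.
  move=> e0; have : \forall n \near \oo, (\int[mu]_(t in D) `|f t - s n t|%:E < (c^-1 * e)%:E)%E.
    apply: (intfs [set z | (z < (c^-1 * e)%:E)%E]); exists (c^-1 * e).
      by rewrite /= mulr_gt0// invr_gt0.
    by move=> z /=; rewrite sub0r normrN lte_fin; apply: le_lt_trans; exact: ler_norm.
  apply: filterS => n /ltW sm; apply: le_trans (dle n) _.
  by rewrite -lee_pdivlMl// -EFinM.
have intd n e : (\int[mu]_(t in D) `|(d n t)%:E| <= e%:E)%E -> mu.-integrable D (EFin \o d n).
  move=> de; apply/integrableP; split; last by apply: le_lt_trans de _; rewrite ltry.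
  by apply/measurable_EFinP; apply: measurable_funTS; exact: (md n).
have hE n : h = (fun t => d n t + s n t v) by apply/funext => t; rewrite /d subrK.
have inth : mu.-integrable D (EFin \o h).
  have /filter_ex[n dn] := small 1 ltr01.
  rewrite (hE n); exact: (integrableD mD' (intd _ _ dn) (intsv n).1).
exists h; split => //.
apply/eqP; rewrite -subr_eq0 -normr_le0; apply/ler_addgt0Pl => e e0; rewrite addr0.
have six' : \forall n \near \oo, `|simple_integral D (s n) v - x v| <= e / 2.
  have : \forall n \near \oo, `|x - simple_integral D (s n)| <= c^-1 * (e / 2).
    by move/cvgrPdist_le : six; apply; rewrite mulr_gt0 ?invr_gt0// divr_gt0.
  by apply: filterS => n; rewrite distrC ler_pdivlMl// => h'; exact: le_trans (evalB _ _) h'.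
have e20 : 0 < e / 2 by rewrite divr_gt0.
have [n [dn xn]] := filter_ex (filterI (small _ e20) six').
have -> : \int[mu]_(t in D) h t = \int[mu]_(t in D) (d n t) + simple_integral D (s n) v.
  rewrite [in LHS](hE n) RintegralD//; last by have [] := intsv n. 
    congr (_ + _); rewrite /Rintegral; by have [_ ->] := intsv n.
  exact: (intd _ _ dn).
rewrite -addrA (splitr e); apply: le_trans (ler_normD _ _) _; apply: lerD => //.
apply: le_trans (le_normr_Rintegral _ (intd _ _ dn)) _ => //.
by rewrite /Rintegral -lee_fin fineK// fin_num_abs// gee0_abs ?integral_ge0// (le_lt_trans dn) ?ltry.
Qed.

End BochnerEval.

(** * The inner product of the pivot space *)

Section InnerProduct.
Context (R : realType) (V H : completeNormedModType R) (T : evolution_triple V H).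
Notation ip := (inner T).
Implicit Types (a b c : H).

Lemma ipC a b : ip a b = ip b a.
Proof. by rewrite hermC expr0 mul1r. Qed.

Lemma ipBl a b c : ip (a - b) c = ip a c - ip b c.
Proof. exact: linearBl. Qed.

Lemma ipBr a b c : ip c (a - b) = ip c a - ip c b.
Proof. by rewrite ipC ipBl !(ipC c). Qed.

Lemma ipZl (k : R) a b : ip (k *: a) b = k * ip a b.
Proof. by rewrite linearZl_LR. Qed.

Lemma ipZr (k : R) a b : ip a (k *: b) = k * ip a b.
Proof. by rewrite ipC ipZl ipC. Qed.

Lemma normB_sqr a b : `|a - b| ^+ 2 = `|a| ^+ 2 - `|b| ^+ 2 - 2 * ip (a - b) b.
Proof.
by rewrite -!(innerE T) !(ipBl, ipBr) (ipC b a); ring.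
Qed.

Lemma cauchy_schwarz a b : `|ip a b| <= `|a| * `|b|.
Proof.
have [->|b0] := eqVneq b 0.
  by rewrite -[X in ip a X](scale0r 0) ipZr mul0r !normr0 mulr0.
have b0' : 0 < `|b| by rewrite normr_gt0.
have : 0 <= `|(`|b| ^+ 2) *: a - ip a b *: b| ^+ 2 by rewrite sqr_ge0.
rewrite -(innerE T) !(ipBl, ipBr, ipZl, ipZr) (ipC b a) !innerE.
rewrite [X in 0 <= X](_ : _ = `|b| ^+ 2 * ((`|a| * `|b|) ^+ 2 - ip a b ^+ 2)); last by ring.
rewrite pmulr_rge0 ?exprn_gt0// subr_ge0 -(real_normK (num_real (ip a b))).
by rewrite ler_sqr ?nnegrE ?mulr_ge0.
Qed.

End InnerProduct.

(** * Increments and distributional derivatives *)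

Section Increment.
Context (R : realType).
Notation mu := (@lebesgue_measure R).

Lemma young_powR (p q a b : R) : 0 < p -> 0 < q -> p^-1 + q^-1 = 1 ->
  0 <= a -> 0 <= b -> a * b <= a `^ p + b `^ q.
Proof.
move=> p0 q0 pq a0 b0; apply: le_trans (conjugate_powR a0 b0 p0 q0 pq) _.
have pi : p^-1 <= 1 by rewrite -pq lerDl invr_ge0 ltW.
have qi : q^-1 <= 1 by rewrite -pq lerDr invr_ge0 ltW.
by apply: lerD; rewrite ler_piMr// powR_ge0.
Qed.

Lemma lower_integral_subset (D D' : set R) (f : R -> \bar R) :
  D `<=` D' -> (forall x, D' x -> 0 <= f x)%E ->
  (\int[mu]_(x in D) f x <= \int[mu]_(x in D') f x)%E.
Proof.
move=> DD' f0; rewrite [leLHS]integral_mkcond [leRHS]integral_mkcond.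
apply: ae_ge0_le_lower_integral => [x _|x _|].
- by apply: erestrict_ge0 => y /DD'; exact: f0.
- exact: erestrict_ge0.
apply: nearW => x _; rewrite /patch; case: ifPn => xD; last first.
  by case: ifPn => // /set_mem; exact: f0.
by rewrite mem_set//; apply: DD'; exact: set_mem.
Qed.

Lemma mu_oitv_lty (a b : R) : (mu `]a, b[%classic < +oo)%E.
Proof. by rewrite lebesgue_measure_itv/=; case: ifP => _; rewrite ltry. Qed.

Lemma integral_cst_oitv (k a b : R) : a < b ->
  (\int[mu]_(t in `]a, b[) k%:E = (k * (b - a))%:E)%E.
Proof.
by move=> ab; rewrite -(@integral_itv_bndoo _ a b _ true false)// integral_cst_segment// ltW.
Qed.

(** Pointwise, [|phi g v| <= |v| |g| <= |v|^p + |g|^q].  Only the positive part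
    of the evaluated integrand above [|v|^p] is compared with [|g|^q], so that
    the lower integral of [|g|^q] need not be additive. *)
Lemma bochner_pairing_le (V : completeNormedModType R) (p q a b : R)
    (g : R -> dual V) (phi : R -> R) (x : dual V) v :
  0 < p -> 0 < q -> p^-1 + q^-1 = 1 -> a < b ->
  (forall t, 0 <= phi t) -> (forall t, phi t <= 1) ->
  is_bochner_integral `]a, b[ (fun t => phi t *: g t) x ->
  (`|x v|%:E <= ((b - a) * `|v| `^ p)%:E + \int[mu]_(t in `[a, b]) (`|g t| `^ q)%:E)%E.
Proof.
move=> p0 q0 pq ab phi0 phi1 bx.
have [h [mh hg ih <-]] := bochner_integral_eval v (measurable_itv _) (mu_oitv_lty a b) bx.
set D := `]a, b[%classic.
pose c := `|v| `^ p; have c0 : 0 <= c by exact: powR_ge0.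
pose k t := Num.max (`|h t| - c) 0.
have mk : measurable_fun setT k.
  apply: measurable_maxr => //; apply: measurable_funB => //.
  exact: (measurableT_comp (@normr_measurable R setT) mh).
have k0 t : 0 <= k t by rewrite /k le_max lexx orbT.
have hk t : `|h t| <= c + k t by rewrite /k -lerBlDl le_max lexx.
have kg : (\int[mu]_(t in D) (k t)%:E <= \int[mu]_(t in `[a, b]) (`|g t| `^ q)%:E)%E.
  apply: (@le_trans _ _ (\int[mu]_(t in D) (`|g t| `^ q)%:E)%E); last first.
    apply: lower_integral_subset; first exact: subset_itv_oo_cc.
    by move=> t _; rewrite lee_fin powR_ge0.
  apply: ae_ge0_le_lower_integral.
  - by move=> t _; rewrite lee_fin.
  - by move=> t _; rewrite lee_fin powR_ge0.
  move: hg; apply: filterS => t + Dt => /(_ Dt) ht.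
  rewrite lee_fin /k ht ge_max powR_ge0 andbT lerBlDl.
  apply: le_trans (young_powR p0 q0 pq (normr_ge0 v) (normr_ge0 (g t))).
  rewrite mulrC; have -> : (phi t *: g t) v = phi t * g t v by [].
  rewrite normrM ger0_norm//; apply: le_trans (dual_norm_eval (g t) v).
  by rewrite ler_piMl.
apply: (@le_trans _ _ (\int[mu]_(t in D) (c + k t)%:E)%E).
  apply: (@le_trans _ _ (\int[mu]_(t in D) `|(h t)%:E|)%E).
    rewrite EFin_normr_Rintegral//; last exact: measurable_itv.
    apply: le_abse_integral; first exact: measurable_itv.
    by apply/measurable_EFinP; apply: measurable_funTS.
  apply: ae_ge0_le_lower_integral => // [t _|].
    by rewrite lee_fin addr_ge0.
  by apply: nearW => t _; rewrite lee_fin.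
under eq_integral do rewrite EFinD.
rewrite ge0_integralD//; last 3 first.
- exact: measurable_itv.
- by move=> t _; rewrite lee_fin.
- by apply/measurable_EFinP; apply: measurable_funTS.
by rewrite integral_cst_oitv// mulrC leeD.
Qed.

End Increment.

Section Concentration.
Context (R : realType).
Variable step : R -> R.
Hypotheses (smooth_step : smooth step)
  (step0 : forall x, x <= 0 -> step x = 0) (step1 : forall x, 1 <= x -> step x = 1)
  (step_ge0 : forall x, 0 <= step x) (step_le1 : forall x, step x <= 1).

(** The function is locally constant there. *)
Lemma derive1_step_out x : x < 0 \/ 1 < x -> derive1 step x = 0.
Proof.
move=> x01; have [c cx] : exists c : R, \forall z \near x, cst c z = step z.
  case: x01 => x01; [exists 0|exists 1]; near=> z.
    by rewrite step0//; apply: ltW; near: z; exact: lt_nbhsl.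
  by rewrite step1//; apply: ltW; near: z; exact: lt_nbhsr.
have dc : is_derive x 1 step 0 by exact: (near_eq_is_derive cx (is_derive_cst _ _ _)).
by rewrite derive1E derive_val.
Unshelve. all: by end_near. Qed.

Lemma derive1_step_bounded : exists2 M, 0 <= M & forall x, `|derive1 step x| <= M.
Proof.
have cd : continuous (fun x => `|derive1 step x|).
  move=> x; apply: cvg_norm; move: x.
  exact/smooth_continuous/smooth_derive/smooth_step.
have [c _ cM] := EVT_max ler01 (continuous_subspaceT cd).
exists `|derive1 step c|; first exact: normr_ge0.
move=> x.
have [x0|x0] := ltP x 0; first by rewrite derive1_step_out ?normr0//; left.
have [x1|x1] := ltP 1 x; first by rewrite derive1_step_out ?normr0//; right.
by apply: cM; rewrite in_itv/= x0 x1.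
Qed.


(** [up] rises from 0 to 1 on [a + e, a + 2 e], [down] falls from 1 to 0 on
    [b - 2 e, b - e]. *)
Definition up (a e t : R) : R := step (e^-1 * t + (- (a + e) / e)).
Definition down (b e t : R) : R := step (- e^-1 * t + (b - e) / e).

Lemma smooth_up a e : smooth (up a e).
Proof. by apply: smooth_comp; [exact: smooth_step|exact: smooth_affine]. Qed.

Lemma smooth_down b e : smooth (down b e).
Proof. by apply: smooth_comp; [exact: smooth_step|exact: smooth_affine]. Qed.

Section plateau.
Variables (a b e : R).
Hypotheses (e0 : 0 < e) (eab : a + 2 * e <= b - 2 * e).

Lemma upE t : up a e t = step ((t - a - e) / e).
Proof. by rewrite /up; congr step; field; rewrite gt_eqF. Qed.

Lemma downE t : down b e t = step ((b - e - t) / e).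
Proof. by rewrite /down; congr step; field; rewrite gt_eqF. Qed.

Lemma up0 t : t <= a + e -> up a e t = 0.
Proof.
by move=> ?; rewrite upE step0// pmulr_lle0 ?invr_gt0// -addrA -opprD subr_le0.
Qed.

Lemma up1 t : a + 2 * e <= t -> up a e t = 1.
Proof. by move=> ?; rewrite upE step1// ler_pdivlMr// mul1r; lra. Qed.

Lemma down0 t : b - e <= t -> down b e t = 0.
Proof. by move=> ?; rewrite downE step0// pmulr_lle0 ?invr_gt0// subr_le0. Qed.

Lemma down1 t : t <= b - 2 * e -> down b e t = 1.
Proof. by move=> ?; rewrite downE step1// ler_pdivlMr// mul1r; lra. Qed.

(** A test function on [a, b] equal to 1 on [a + 2 e, b - 2 e].  As a sum rather
    than a product, its derivative is the sum of two bumps. *)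
Definition plateau (t : R) : R := up a e t + (down b e t + -1).

Lemma plateau_ge0 t : 0 <= plateau t.
Proof.
rewrite /plateau; have [tb|tb] := leP t (b - 2 * e).
  by rewrite (down1 tb) subrr addr0; exact: step_ge0.
by rewrite up1 ?(le_trans eab (ltW tb))// addrCA subrr addr0; exact: step_ge0.
Qed.

Lemma plateau_le1 t : plateau t <= 1.
Proof.
rewrite /plateau; have [tb|tb] := leP t (b - 2 * e).
  by rewrite (down1 tb) subrr addr0; exact: step_le1.
by rewrite up1 ?(le_trans eab (ltW tb))// addrCA subrr addr0; exact: step_le1.
Qed.

Lemma plateau_test : test_function a b plateau.
Proof.
split=> [n t|].
  apply: smooth_derivable; apply: (@smoothD _ (up a e) (down b e \+ cst (-1))).
    exact: smooth_up.
  by apply: smoothD; [exact: smooth_down|exact: smooth_cst].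
exists (a + e), (b - e); split; [by rewrite ltrDl|by rewrite gtrBl|].
move=> t /=; rewrite in_itv/= => /negP; rewrite negb_and -!ltNge /plateau.
move=> /orP[ta|tb].
  have tb : t <= b - 2 * e by apply: le_trans (ltW ta) _; move: e0 eab; lra.
  by rewrite (up0 (ltW ta)) (down1 tb) subrr addr0.
have ta : a + 2 * e <= t by apply: le_trans (ltW tb); move: e0 eab; lra.
by rewrite (down0 (ltW tb)) (up1 ta) add0r subrr.
Qed.

Lemma derive1_affine (k l t : R) : is_derive t 1 (fun t => k * t + l) k.
Proof.
have -> : (fun t => k * t + l) = (cst k * id) + cst l by apply/funext => ?; rewrite !fctE.
have dM := is_deriveM (is_derive_cst k t 1) (is_derive_id t 1).
apply: (is_derive_eq (is_deriveD dM (is_derive_cst l t 1))).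
by rewrite !fctE /GRing.scale/= mulr1 mulr0 !addr0.
Qed.

Lemma derive1_affineE (k l t : R) : derive1 (fun t => k * t + l) t = k.
Proof. by have dA := derive1_affine k l t; rewrite derive1E derive_val. Qed.

Lemma derivable_step (t : R) : derivable step t 1.
Proof. exact: (@smooth_derivable _ step 0%N t smooth_step). Qed.

Lemma derive1_up t : derive1 (up a e) t = derive1 step ((t - a - e) / e) / e.
Proof.
rewrite derive1_comp.
- rewrite derive1_affineE.
  by have -> : e^-1 * t + - (a + e) / e = (t - a - e) / e by field; rewrite gt_eqF.
- by have [] := derive1_affine (e^-1) (- (a + e) / e) t.
- exact: derivable_step.
Qed.

Lemma derive1_down t : derive1 (down b e) t = - derive1 step ((b - e - t) / e) / e.
Proof.
rewrite derive1_comp.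
- rewrite derive1_affineE.
  have -> : - e^-1 * t + (b - e) / e = (b - e - t) / e by field; rewrite gt_eqF.
  by rewrite mulrN mulNr.
- by have [] := derive1_affine (- e^-1) ((b - e) / e) t.
- exact: derivable_step.
Qed.

Lemma derive1_plateau t :
  derive1 plateau t = derive1 (up a e) t + derive1 (down b e) t.
Proof.
exact: (derive1_smoothDcst (-1) t (smooth_up a e) (smooth_down b e)).
Qed.

End plateau.
End Concentration.

Section IncrementBound.
Context (R : realType).
Notation mu := (@lebesgue_measure R).

Lemma integral_indic_segment_le (D : set (g_sigma_algebraType R.-ocitv.-measurable))
    (c d : R) : measurable D -> c <= d ->
  (\int[mu]_(t in D) (\1_(`[c, d]%classic) t)%:E <= (d - c)%:E)%E.
Proof.
move=> mD cd.
have mI : measurable (`[c, d]%classic : set (g_sigma_algebraType R.-ocitv.-measurable)).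
  exact: measurable_itv.
rewrite (integral_indic _ mD mI) -(lebesgue_measure_segment cd).
by apply: le_measure; rewrite ?inE//; exact: measurableI.
Qed.

(** For a plateau function [phi] with steep edges, [phi'] is close to a Dirac
    mass at [a] minus a Dirac mass at [b].  The integrand [h] is compared with
    the derivative [k] of [u a * up + u b * down], whose integral is exactly
    [u a - u b]: both bumps have size at most [M / e] on an interval of length
    [2 e], where [u] varies by at most [dl]. *)
Lemma derivative_concentrates (a b : R) (u : R -> R) (d : R) : a < b -> 0 < d ->
  (forall e, 0 < e -> exists2 n, 0 < n & forall t, a <= t -> t <= a + n -> `|u t - u a| <= e) ->
  (forall e, 0 < e -> exists2 n, 0 < n & forall t, b - n <= t -> t <= b -> `|u t - u b| <= e) ->
  exists phi, [/\ test_function a b phi, forall t, 0 <= phi t, forall t, phi t <= 1 &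
    forall h, measurable_fun setT h -> mu.-integrable `]a, b[ (EFin \o h) ->
      {ae mu, forall t, `]a, b[%classic t -> h t = derive1 phi t * u t} ->
      `|\int[mu]_(t in `]a, b[) h t - (u a - u b)| <= d].
Proof.
move=> ab d0 ua ub.
have [step [sstep step0 step1 step_ge0 step_le1]] := exists_smooth_step R.
have [M M0 stepM] := derive1_step_bounded sstep step0 step1.
pose dl := d / (4 * M + 1).
have M4 : 0 < 4 * M + 1 by rewrite ltr_wpDl// mulr_ge0.
have dl0 : 0 < dl by rewrite divr_gt0.
have [n1 n10 {}ua] := ua _ dl0; have [n2 n20 {}ub] := ub _ dl0.
pose e := Num.min (Num.min (n1 / 2) (n2 / 2)) ((b - a) / 4).
have e0 : 0 < e by rewrite !lt_min !divr_gt0//= subr_gt0.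
have en1 : 2 * e <= n1 by rewrite -ler_pdivlMl// mulrC !ge_min lexx.
have en2 : 2 * e <= n2 by rewrite -ler_pdivlMl// mulrC !ge_min lexx orbT.
have eab : a + 2 * e <= b - 2 * e.
  have : e <= (b - a) / 4 by rewrite !ge_min lexx orbT.
  by rewrite ler_pdivlMr//; move: e0; lra.
exists (plateau step a b e); split.
- exact: plateau_test.
- exact: plateau_ge0.
- exact: plateau_le1.
move=> h mh ih hE.
pose D := (`]a, b[%classic : set (g_sigma_algebraType R.-ocitv.-measurable)).
have mD : measurable D by exact: measurable_itv.
pose F := (cst (u a) \* up step a e) \+ (cst (u b) \* down step b e).
pose k := derive1 F.
have sF : smooth F.
  apply: smoothD; apply: smoothM; [exact: smooth_cst|exact: smooth_up|exact: smooth_cst|].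
  exact: smooth_down.
have sk : smooth k by exact: smooth_derive.
have kE t : k t = u a * derive1 (up step a e) t + u b * derive1 (down step b e) t.
  have su := smooth_up sstep a e; have sd := smooth_down sstep b e.
  exact: (derive1_smooth_combination (u a) (u b) t su sd).
have ck : continuous k by exact: smooth_continuous.
have mk : measurable_fun setT k by exact: continuous_measurable_fun.
have ik' : mu.-integrable `[a, b] (EFin \o k).
  apply: continuous_compact_integrable; first exact: segment_compact.
  exact: continuous_subspaceT.
have ik : mu.-integrable D (EFin \o k).
  by apply: integrableS ik' => //; exact: subset_itv_oo_cc.
have intk : \int[mu]_(t in D) k t = u a - u b.
  rewrite /Rintegral -(@integral_itv_bndoo _ a b _ true false); last first.
    by apply/measurable_EFinP; apply: measurable_funTS.
  have cF := smooth_continuous sF.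
  rewrite (@continuous_FTC2 _ k F a b ab); last 3 first.
  - exact: continuous_subspaceT.
  - split.
    + by move=> t _; exact: (@smooth_derivable _ _ 0%N t sF).
    + by apply: cvg_at_right_filter; exact: cF.
    + by apply: cvg_at_left_filter; exact: cF.
  - by [].
  have ub1 : up step a e b = 1 by apply: up1 => //; move: e0 eab; lra.
  have ua0 : up step a e a = 0 by apply: up0 => //; move: e0 eab; lra.
  have da1 : down step b e a = 1 by apply: down1 => //; move: e0 eab; lra.
  have db0 : down step b e b = 0 by apply: down0 => //; move: e0 eab; lra.
  by rewrite /F /= ub1 ua0 da1 db0 !mulr0 !mulr1 addr0 add0r.
(* [4 * M * dl <= d] by the choice of [dl]. *)
pose B t := (dl * (M / e)) * (\1_(`[a, a + 2 * e]%classic) t + \1_(`[b - 2 * e, b]%classic) t) : R.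
have Me0 : 0 <= dl * (M / e) by rewrite mulr_ge0 ?divr_ge0// ltW.
have hkB : {ae mu, forall t, D t -> `|h t - k t| <= B t}.
  move: hE; apply: filterS => t + Dt => /(_ Dt) ->.
  have /andP[at_ tb] : a < t < b by move: Dt; rewrite /D /= in_itv.
  rewrite kE derive1_plateau// mulrDl opprD addrACA ![_ * u t]mulrC -!mulrBl.
  apply: le_trans (ler_normD _ _) _; rewrite /B mulrDr; apply: lerD; rewrite normrM.
    rewrite indicE mem_setE in_itv/= (ltW at_)/=; have [ta|ta] := leP t (a + 2 * e).
      rewrite mulr1 ler_pM//; first by apply: ua; [exact: ltW|lra].
      by rewrite derive1_up// normrM normfV (gtr0_norm e0) ler_wpM2r// invr_ge0 ltW.
    rewrite mulr0 derive1_up// derive1_step_out ?mul0r ?normr0 ?mulr0//; right.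
    by rewrite ltr_pdivlMr//; move: ta; lra.
  rewrite indicE mem_setE in_itv/= (ltW tb) andbT; have [ta|ta] := leP (b - 2 * e) t.
    rewrite mulr1 ler_pM//; first by apply: ub; [lra|exact: ltW].
    by rewrite derive1_down// normrM normrN normfV (gtr0_norm e0) ler_wpM2r// invr_ge0 ltW.
  rewrite mulr0 derive1_down// derive1_step_out ?oppr0 ?mul0r ?normr0 ?mulr0//; right.
  by rewrite ltr_pdivlMr//; move: ta; lra.
have ihk : mu.-integrable D (EFin \o (fun t => h t - k t)).
  exact: (integrableB mD ih ik).
have hkd : (\int[mu]_(t in D) `|(h t - k t)%:E| <= d%:E)%E.
  apply: (@le_trans _ _ (\int[mu]_(t in D) (B t)%:E)%E).
    apply: ae_ge0_le_lower_integral => [t _|t _|].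
    - by rewrite lee_fin.
    - by rewrite lee_fin mulr_ge0// addr_ge0.
    - by move: hkB; apply: filterS => t + Dt => /(_ Dt); rewrite lee_fin.
  have mA (c c1 : R) : measurable_fun D (fun t => (\1_(`[c, c1]%classic) t)%:E).
    by apply/measurable_EFinP; apply: measurable_indic; exact: measurable_itv.
  pose A1 t : \bar R := (\1_(`[a, a + 2 * e]%classic) t)%:E.
  pose A2 t : \bar R := (\1_(`[b - 2 * e, b]%classic) t)%:E.
  have A10 t : D t -> (0 <= A1 t)%E by rewrite lee_fin.
  have A20 t : D t -> (0 <= A2 t)%E by rewrite lee_fin.
  have mA1 : measurable_fun D A1 by exact: mA.
  have mA2 : measurable_fun D A2 by exact: mA.
  have mS : measurable_fun D (fun t => A1 t + A2 t)%E by exact: emeasurable_funD.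
  have S0 t : D t -> (0 <= A1 t + A2 t)%E by move=> Dt; rewrite adde_ge0// ?A10 ?A20.
  rewrite (_ : integral _ _ _ = \int[mu]_(t in D) ((dl * (M / e))%:E * (A1 t + A2 t)))%E//.
  rewrite (ge0_integralZl _ mD mS S0)//.
  rewrite (ge0_integralD _ mD A10 mA1 A20 mA2).
  have cl : (\int[mu]_(t in D) A1 t + \int[mu]_(t in D) A2 t <= (2 * e + 2 * e)%:E)%E.
    rewrite EFinD; apply: leeD.
      apply: le_trans (integral_indic_segment_le mD _) _; first by rewrite lerDl mulr_ge0// ltW.
      by rewrite lee_fin addrAC subrr add0r.
    apply: le_trans (integral_indic_segment_le mD _) _; first by rewrite gerBl mulr_ge0// ltW.
    by rewrite lee_fin opprB addrCA subrr addr0.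
  apply: le_trans (lee_wpmul2l _ cl) _; first by rewrite lee_fin.
  have cancel (x m y : R) : y != 0 -> x * (m / y) * (2 * y + 2 * y) = x * (4 * m).
    by move=> y0; field.
  rewrite -EFinM lee_fin cancel ?gt_eqF//.
  by rewrite /dl mulrAC ler_pdivrMr// ler_pM2l// lerDl.
rewrite -intk -RintegralB//.
apply: le_trans (le_normr_Rintegral mD ihk) _.
rewrite /Rintegral -lee_fin fineK// fin_num_abs// gee0_abs ?integral_ge0// (le_lt_trans hkd) ?ltry//.
Qed.

End IncrementBound.

Section IncrementTriple.
Context (R : realType) (V H : completeNormedModType R) (T : evolution_triple V H).
Variables (p q : R).
Hypotheses (p0 : 0 < p) (q0 : 0 < q) (pq : p^-1 + q^-1 = 1).
Notation mu := (@lebesgue_measure R).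

Lemma within_segment_endpoints (a b : R) (y : R -> H) : a < b ->
  {within `[a, b], continuous y} -> forall d, 0 < d ->
  (exists2 n, 0 < n & forall t, a <= t -> t <= a + n -> `|y t - y a| <= d) /\
  (exists2 n, 0 < n & forall t, b - n <= t -> t <= b -> `|y t - y b| <= d).
Proof.
move=> ab /(continuous_within_itvP _ ab)[_ ya yb] d d0; split.
- move/cvgrPdist_le : ya => /(_ _ d0)[n /= n0 yn]; exists (n / 2); first by rewrite divr_gt0.
  move=> t; rewrite le_eqVlt => /predU1P[->|at_] tn; first by rewrite subrr normr0 ltW.
  rewrite distrC; apply: yn => //=; rewrite distrC gtr0_norm ?subr_gt0//.
  by rewrite ltrBlDl (le_lt_trans tn)// ltrD2l ltr_pdivrMr// ltr_pMr// ltr1n.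
- move/cvgrPdist_le : yb => /(_ _ d0)[n /= n0 yn]; exists (n / 2); first by rewrite divr_gt0.
  move=> t tn; rewrite le_eqVlt => /predU1P[->|tb]; first by rewrite subrr normr0 ltW.
  rewrite distrC; apply: yn => //=; rewrite gtr0_norm ?subr_gt0//.
  rewrite ltrBlDl -ltrBlDr (lt_le_trans _ tn)// ltrD2l ltrN2.
  by rewrite ltr_pdivrMr// ltr_pMr// ltr1n.
Qed.

(** Testing the derivative against steep plateau functions: on one side the
    pairing with [- phi' y] tends to the increment, on the other side
    [bochner_pairing_le] bounds the pairing with [phi g]. *)
Lemma increment_pairing_le (a b : R) (y : R -> H) (g : R -> dual V) v : a < b ->
  {within `[a, b], continuous y} -> distr_derivative T a b y g ->
  (`|inner T (y b - y a) (embVH T v)|%:E <=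
     ((b - a) * `|v| `^ p)%:E + \int[mu]_(t in `[a, b]) (`|g t| `^ q)%:E)%E.
Proof.
move=> ab cy yg; apply/lee_addgt0Pr => d d0.
pose u t := inner T (y t) (embVH T v).
pose c := `|embVH T v| + 1; have c0 : 0 < c by rewrite ltr_wpDl.
have uB t s : `|u t - u s| <= c * `|y t - y s|.
  rewrite /u -ipBl; apply: le_trans (cauchy_schwarz _ _ _) _.
  by rewrite mulrC ler_wpM2r// lerDl.
have yd e (e0 : 0 < e) : 0 < c^-1 * e by rewrite mulr_gt0// invr_gt0.
have [phi [tphi phi0 phi1 conc]] : exists phi, [/\ test_function a b phi,
    forall t, 0 <= phi t, forall t, phi t <= 1 &
    forall h, measurable_fun setT h -> mu.-integrable `]a, b[ (EFin \o h) ->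
      {ae mu, forall t, `]a, b[%classic t -> h t = derive1 phi t * u t} ->
      `|\int[mu]_(t in `]a, b[) h t - (u a - u b)| <= d].
  apply: derivative_concentrates => // e e0;
    have [[n1 n10 h1] [n2 n20 h2]] := within_segment_endpoints ab cy (yd e e0).
    exists n1 => // t ta tn; apply: le_trans (uB _ _) _.
    by rewrite -ler_pdivlMl//; exact: h1.
  exists n2 => // t ta tn; apply: le_trans (uB _ _) _.
  by rewrite -ler_pdivlMl//; exact: h2.
have [x [bx1 bx2]] := yg phi tphi.
have [h [mh hE ih intE]] := bochner_integral_eval v (measurable_itv _) (mu_oitv_lty a b) bx1.
have {}conc : `|x v - (u a - u b)| <= d.
  rewrite -intE; apply: conc => //; move: hE; apply: filterS => t + Dt => /(_ Dt) ->.
  by rewrite [LHS]/(_ * _) /u -embHDE.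
have := bochner_pairing_le v p0 q0 pq ab phi0 phi1 bx2.
have -> : (- x) v = - x v by []. 
rewrite normrN => xle.
apply: (@le_trans _ _ (`|x v|%:E + d%:E)%E); last exact: leeD.
rewrite -EFinD lee_fin ipBl -/(u b) -/(u a) distrC.
have -> : u a - u b = x v - (x v - (u a - u b)) by ring.
by apply: le_trans (ler_normB _ _) _; rewrite lerD2l.
Qed.

End IncrementTriple.

(** * Trajectories controlled by an energy *)

Section ControlledTrajectories.
Context (R : realType) (V H : completeNormedModType R) (T : evolution_triple V H).
Variable p : R.

(** Everything about a trajectory that the dynamics depends on, stated with real
    numbers only.  The map [e] is the energy, read through the translation that
    defines the element of the united trajectory space; [k] encodes a
    modulus of uniform integrability, [d + k d * h] being a bound of the
    integral over any interval of length [h <= 1]. *)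
Record controlled (a1 a2 : R) (k : R -> R) (z : R -> H) (e : R -> R -> R) : Prop := {
  ctrl_ge0 : forall s t, 0 <= e s t ;
  ctrl_split : forall r s t, 0 <= r -> r <= s -> s <= t -> e r s + e s t <= e r t ;
  ctrl_point : forall s t l, 0 <= s -> s < t -> e s t < l * (t - s) ->
    exists r v, [/\ s <= r, r <= t, embVH T v = z r & `|v| `^ p <= l] ;
  ctrl_weak : forall d s t v, 0 < d -> 0 <= s -> s <= t -> t <= s + 1 ->
    `|inner T (z t - z s) (embVH T v)| <=
      (t - s) * `|v| `^ p + a2 * e s t + (d + k d * (t - s)) ;
  ctrl_norm : forall d s t, 0 < d -> 0 <= s -> s <= t -> t <= s + 1 ->
    `|z t| ^+ 2 - `|z s| ^+ 2 + a1 * e s t <= d + k d * (t - s) }.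

Variables (q : R) (K : R -> set (R -> H)).
Hypotheses (p0 : 0 < p) (q0 : 0 < q) (pq : p^-1 + q^-1 = 1).
Hypothesis KW : forall tau, 0 <= tau -> K tau `<=` Wloc T p q tau.
Hypotheses (A1 : condA1 T p K) (A2 : condA2 T p q K).
Notation mu := (@lebesgue_measure R).

Lemma energy_split tau y r s t : Wloc T p q tau y -> tau <= r -> r <= s -> s <= t ->
  energy T p y r s + energy T p y s t = energy T p y r t.
Proof.
move=> Wy tr rs st.
have mem a : tau <= a -> a <= t -> memLpV T p a (t + 1) y.
  move=> ta at_; have at1 : a < t + 1 by apply: le_lt_trans at_ _; rewrite ltrDl.
  by have [] := Wy a (t + 1) ta at1.
have t1 : t <= t + 1 by rewrite lerDl.
have [_ h1] := memLpV_integral_split rs (le_trans st t1) (mem r tr (le_trans rs st)).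
have [_ h2] := memLpV_integral_split (le_trans rs st) t1 (mem r tr (le_trans rs st)).
have [_ h3] := memLpV_integral_split st t1 (mem s (le_trans tr rs) st).
lra.
Qed.

(** The constants and the modulus are common to all trajectories, because uniform
    integrability absorbs the translation. *)
Lemma Kcup_controlled : exists a1 a2 k, [/\ 0 < a1, 0 < a2, forall d, 0 < d -> 0 <= k d &
  forall z, Kcup K z -> exists e, controlled a1 a2 k z e].
Proof.
have [c1 [a1 [tui1 c10 a10 H1]]] := A1; have [c2 [a2 [tui2 c20 a20 H2]]] := A2.
have mod c : tui c -> (forall t, 0 <= t -> 0 <= c t) -> exists k : R -> R,
    forall d, 0 < d -> 0 <= k d /\ forall s t, 0 <= s -> s <= t -> t <= s + 1 ->
    (\int[mu]_(r in `[s, t]) (c r)%:E <= (d + k d * (t - s))%:E)%E.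
  move=> tc c0; suff /choice[k kP] : forall d : R, exists k : R, 0 < d -> 0 <= k /\
      forall s t, 0 <= s -> s <= t -> t <= s + 1 ->
      (\int[mu]_(r in `[s, t]) (c r)%:E <= (d + k * (t - s))%:E)%E by exists k.
  move=> d; have [d0|_] := ltP 0 d; last by exists 0.
  by have [k k0 kP] := tui_integral_segment tc c0 d0; exists k.
have [k1 k1P] := mod _ tui1 c10; have [k2 k2P] := mod _ tui2 c20.
exists a1, a2, (fun d => k1 d + k2 d); split => // [d d0|z [tau [h [y [tau0 h0 Ky ->]]]]].
  by rewrite addr_ge0 ?(k1P _ d0).1 ?(k2P _ d0).1.
have Wy := KW tau0 Ky; set w := Defs.shift h _; pose sg := h + tau.
have wE s : w s = y (s + sg) by rewrite /w /Defs.shift /sg addrA.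
have sg0 : tau <= sg by rewrite /sg lerDr.
have tsg s : 0 <= s -> tau <= s + sg by move=> s0; apply: le_trans sg0 _; rewrite lerDr.
have sg1 s t : t <= s + 1 -> t + sg <= s + sg + 1 by move=> ?; rewrite -addrAC lerD2r.
have subsg s t : (t + sg) - (s + sg) = t - s by rewrite opprD addrACA subrr addr0.
have memw s t : 0 <= s -> s < t -> memLpV T p (s + sg) (t + sg) y.
  move=> s0 st; have st' : s + sg < t + sg by rewrite ltrD2r.
  by have [] := Wy _ _ (tsg _ s0) st'.
exists (fun s t => energy T p y (s + sg) (t + sg)); split.
- by move=> s t; exact: energy_ge0.
- by move=> r s t r0 rs st; rewrite (energy_split Wy) ?tsg ?lerD2r.
- move=> s t l s0 st; rewrite -subsg => /(energy_small_point _ (memw _ _ s0 st)).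
  rewrite ltrD2r => /(_ st)[r [v [sr rt rv vl]]].
  exists (r - sg), v; split; rewrite ?lerBrDr ?lerBlDr//.
  by rewrite wE subrK.
- move=> d s t v d0 s0; rewrite le_eqVlt => /predU1P[-> _|st ts1].
    rewrite !subrr -[X in inner T X _](scale0r 0) ipZl mul0r normr0 mul0r add0r mulr0 addr0.
    by rewrite addr_ge0 ?(ltW d0)// mulr_ge0 ?energy_ge0// ltW.
  rewrite !wE.
  have st' : s + sg < t + sg by rewrite ltrD2r.
  have [cy _ [g [gq gd]]] := Wy _ _ (tsg _ s0) st'.
  have := increment_pairing_le p0 q0 pq v st' cy gd.
  rewrite subsg => /le_trans h1.
  rewrite -lee_fin; apply: h1; rewrite -addrA EFinD leeD//.
  apply: le_trans (H2 _ _ _ _ tau0 Ky (tsg _ s0) (ltW st') g _) _ => //.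
  rewrite (energyE st' (memw _ _ s0 st)) -EFinM EFinD leeD//.
  apply: le_trans ((k2P _ d0).2 _ _ _ (ltW st') (sg1 _ _ ts1)) _.
    exact: le_trans tau0 (tsg _ s0).
  rewrite subsg lee_fin lerD2l ler_wpM2r ?subr_ge0; [by []|exact: ltW|].
  by rewrite lerDr (k1P _ d0).1.
- move=> d s t d0 s0; rewrite le_eqVlt => /predU1P[<- _|st ts1].
    have e0 : energy T p y (s + sg) (s + sg) = 0.
      by have := energy_split Wy (tsg _ s0) (lexx _) (lexx _); lra.
    by rewrite e0 !subrr !mulr0 !addr0 ltW.
  rewrite !wE.
  have st' : s + sg < t + sg by rewrite ltrD2r.
  have := H1 _ _ _ _ tau0 Ky (tsg _ s0) (ltW st').
  rewrite (energyE st' (memw _ _ s0 st)) => h1.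
  rewrite -lee_fin EFinD EFinM; apply: le_trans h1 _.
  apply: le_trans ((k1P _ d0).2 _ _ _ (ltW st') (sg1 _ _ ts1)) _.
    exact: le_trans tau0 (tsg _ s0).
  rewrite subsg lee_fin lerD2l ler_wpM2r ?subr_ge0; [by []|exact: ltW|].
  by rewrite lerDl (k2P _ d0).1.
Qed.

End ControlledTrajectories.

(** * Dissipativity *)

Section Dissipativity.
Context (R : realType) (V H : completeNormedModType R) (T : evolution_triple V H).
Variables (p a1 a2 : R) (k : R -> R).
Hypotheses (p1 : 1 <= p) (a10 : 0 < a1) (a20 : 0 < a2)
  (k0 : forall d, 0 < d -> 0 <= k d).
Notation ctrl := (controlled T p a1 a2 k).
Implicit Types (z : R -> H) (e : R -> R -> R).

Lemma le_of_powR_le (x l : R) : 0 <= x -> 0 <= l -> x `^ p <= l -> x <= 1 + l.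
Proof.
move=> x0 l0 xl; have [x1|x1] := leP x 1; first by rewrite (le_trans x1)// lerDl.
apply: le_trans (le_trans xl _); last by rewrite lerDr.
by rewrite -[leLHS]powRr1// ler_powR// ltW.
Qed.

Lemma embVH_bounded : exists2 M, 0 < M & forall v, `|embVH T v| <= M * `|v|.
Proof.
have /bounded_funP/(_ 1)[M fM] : bounded_near (embVH T) (nbhs (0 : V)).
  by apply: continuous_linear_bounded; exact: embVH_continuous.
exists (`|M| + 1) => [|v]; first by rewrite ltr_wpDl.
have [->|v0] := eqVneq v 0; first by rewrite linear0 !normr0 mulr0.
have v0' : 0 < `|v| by rewrite normr_gt0.
rewrite -ler_pdivrMr// mulrC.
have -> : `|v|^-1 * `|embVH T v| = `|embVH T (`|v|^-1 *: v)|.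
  by rewrite linearZ normrZ normfV normr_id.
apply: le_trans (fM _ _) _; last by apply: le_trans (ler_norm _) _; rewrite lerDl.
by rewrite normrZ normfV normr_id mulVf// gt_eqF.
Qed.

Lemma ctrl_mono z e s s' t t' : ctrl z e -> 0 <= s' -> s' <= s -> s <= t -> t <= t' ->
  e s t <= e s' t'.
Proof.
move=> ce s0 ss st tt.
have h1 := ctrl_split ce s0 ss (le_trans st tt).
have h2 := ctrl_split ce (le_trans s0 ss) st tt.
by have := ctrl_ge0 ce s' s; have := ctrl_ge0 ce t t'; lra.
Qed.

Lemma ctrl_norm_growth z e d s t : ctrl z e -> 0 < d -> 0 <= s -> s <= t -> t <= s + 1 ->
  `|z t| ^+ 2 <= `|z s| ^+ 2 + (d + k d * (t - s)).
Proof.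
move=> ce d0 s0 st ts; have := ctrl_norm ce d0 s0 st ts.
have : 0 <= a1 * e s t by rewrite mulr_ge0// ?(ctrl_ge0 ce)// ltW.
lra.
Qed.

(** The identity [|b - a|^2 = |b|^2 - |a|^2 - 2 (b - a, a)] turns the one-sided
    control of the norm and the weak control of the increment into strong
    control, provided that the initial value lies in [V]. *)
Lemma ctrl_strong z e d s t v : ctrl z e -> 0 < d -> 0 <= s -> s <= t -> t <= s + 1 ->
  embVH T v = z s ->
  `|z t - z s| ^+ 2 <= 3 * (d + k d * (t - s)) + 2 * ((t - s) * `|v| `^ p) + 2 * a2 * e s t.
Proof.
move=> ce d0 s0 st ts vs; rewrite (normB_sqr T) -vs.
have := ctrl_weak ce v d0 s0 st ts; rewrite ler_norml -vs => /andP[h1 _].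
have := ctrl_norm_growth ce d0 s0 st ts; rewrite -vs.
lra.
Qed.

(** If the energy of [t, t + 1] is at least [l], the energy inequality makes the
    squared norm drop by 1.  Otherwise it is bounded at some time of the window,
    and cannot grow by more than [c] afterwards. *)
Lemma norm_unit_step : exists2 rho, 0 <= rho & forall z e t, ctrl z e -> 0 <= t ->
  `|z (t + 1)| ^+ 2 <= Num.max (`|z t| ^+ 2 - 1) rho.
Proof.
have [M M0 embM] := embVH_bounded.
pose c := 1 + k 1; have c0 : 0 < c by rewrite ltr_pwDl// k0.
pose l := (c + 1) / a1; have l0 : 0 < l by rewrite divr_gt0// addr_gt0.
exists ((M * (1 + l)) ^+ 2 + c); first by rewrite addr_ge0 ?sqr_ge0// ltW.
move=> z e t ce t0; rewrite le_max.
have t1 : t < t + 1 by rewrite ltrDl.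
have [el|el] := ltP (e t (t + 1)) l; last first.
  apply/orP; left; have := ctrl_norm ce ltr01 t0 (ltW t1) (lexx _).
  have : c + 1 <= a1 * e t (t + 1) by rewrite mulrC -ler_pdivrMr.
  by rewrite /c (_ : t + 1 - t = 1); [lra|rewrite addrAC subrr add0r].
apply/orP; right.
have : e t (t + 1) < l * (t + 1 - t) by rewrite addrAC subrr add0r mulr1.
move/(ctrl_point ce t0 t1) => [r [v [tr rt vr vl]]].
have r0 : 0 <= r by exact: le_trans tr.
apply: le_trans (ctrl_norm_growth ce ltr01 r0 rt _) _; first by rewrite lerD2r.
apply: lerD.
  rewrite -vr ler_sqr ?nnegrE// ?mulr_ge0 ?(ltW M0)//; last by rewrite addr_ge0// ltW.
  apply: le_trans (embM v) _; rewrite ler_pM2l//.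
  by apply: le_of_powR_le => //; exact: ltW.
rewrite lerD2l -[leRHS]mulr1 ler_wpM2l ?k0//; lra.
Qed.

(** Uniform boundedness on bounded sets of initial values, and an absorbing
    radius [R0] independent of the initial bound. *)
Lemma norm_bounds : exists2 R0, 0 < R0 & forall B, 0 <= B -> exists B' T0,
  [/\ 0 <= B', 0 <= T0 & forall z e, ctrl z e -> `|z 0| <= B ->
    (forall t, 0 <= t -> `|z t| <= B') /\ (forall t, T0 <= t -> `|z t| <= R0)].
Proof.
have [rho rho0 step1] := norm_unit_step.
pose c := 1 + k 1; have c0 : 0 < c by rewrite ltr_pwDl// k0.
have root (x y : R) : 0 <= x -> 0 <= y -> x ^+ 2 <= y -> x <= y + 1.
  move=> x0 y0 xy; rewrite -ler_sqr ?nnegrE//; last by rewrite addr_ge0.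
  by apply: le_trans xy _; rewrite sqrrD expr1n mulr1; have := sqr_ge0 y; lra.
exists (rho + c + 1); first by rewrite ltr_wpDl// addr_ge0// ltW.
move=> B B0; exists (B ^+ 2 + (rho + c) + 1), (B ^+ 2 + 1); split.
- by rewrite addr_ge0// addr_ge0 ?sqr_ge0// addr_ge0// ltW.
- by rewrite addr_ge0// sqr_ge0.
move=> z e ce zB.
have zB2 : `|z 0| ^+ 2 <= B ^+ 2 by rewrite ler_sqr ?nnegrE.
have stepn (n : nat) : `|z n%:R| ^+ 2 <= Num.max (B ^+ 2 - n%:R) rho.
  elim: n => [|n IH]; first by rewrite subr0 le_max zB2.
  rewrite -natr1; apply: le_trans (step1 _ _ _ ce (ler0n _ _)) _.
  rewrite ge_max !le_max lexx orbT andbT.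
  by move: IH; rewrite le_max => /orP[h|h]; apply/orP; [left|right]; lra.
have near_nat t : 0 <= t -> exists2 n : nat, t < n.+1%:R &
    `|z t| ^+ 2 <= Num.max (B ^+ 2 - n%:R) rho + c.
  move=> t0; have /andP[nt tn] := truncn_itv t0; set n := Num.truncn t in nt tn.
  exists n => //; have tn1 : t <= n%:R + 1 by rewrite natr1 ltW.
  apply: le_trans (ctrl_norm_growth ce ltr01 (ler0n _ _) nt tn1) _.
  rewrite lerD// ?stepn// /c lerD2l -[leRHS]mulr1 ler_wpM2l ?k0//; lra.
split=> t tT.
  have [n _ zt] := near_nat t tT; apply: root => //.
    by rewrite addr_ge0 ?sqr_ge0// addr_ge0// ltW.
  apply: le_trans zt _; rewrite [leRHS]addrA lerD2r ge_max; apply/andP; split.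
    by rewrite lerD// (le_trans _ rho0)// oppr_le0.
  by rewrite lerDr sqr_ge0.
have t0 : 0 <= t by apply: le_trans tT; rewrite addr_ge0// sqr_ge0.
have [n tn zt] := near_nat t t0; apply: root => //; first by rewrite addr_ge0// ltW.
apply: le_trans zt _; rewrite lerD2r ge_max lexx andbT.
by move: tn; rewrite -natr1; lra.
Qed.

End Dissipativity.

(** * Compactness along ultrafilters *)

Section UltrafilterLimits.
Context (I : Type) (U : set_system I) (UU : UltraFilter U).

Lemma ultra_fmap (X : Type) (f : I -> X) : UltraFilter (f @ U).
Proof.
split; first exact: fmap_proper_filter.
move=> G GG UG; rewrite predeqE => A; split; last exact: UG.
move=> GA; have [//|UnA] := in_ultra_setVsetC (f @^-1` A) UU.
have GnA : G (~` A) by apply: UG.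
by have [x [Ax nAx]] := filter_ex (filterI GA GnA).
Qed.

Lemma ultra_compact_cvg (X : topologicalType) (C : set X) (f : I -> X) :
  compact C -> (\forall i \near U, C (f i)) -> exists2 l, C l & f @ U --> l.
Proof.
rewrite compact_ultra => cC UC.
by have [l [Cl fl]] := cC _ (ultra_fmap f) UC; exists l.
Qed.

Lemma ultra_bounded_cvg (R : realType) (f : I -> R) M :
  (forall i, `|f i| <= M) -> cvg (f @ U).
Proof.
move=> fM; have [|l _ fl] := ultra_compact_cvg (@segment_compact _ (- M) M) (f := f).
  by near=> i; rewrite /= in_itv/= -ler_norml.
exact: (cvgP l fl).
Unshelve. all: by end_near. Qed.

End UltrafilterLimits.

Section CompactnessAlongUltrafilter.
Context (R : realType) (V H : completeNormedModType R) (T : evolution_triple V H).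
Variables (p a1 a2 : R) (k : R -> R).
Hypotheses (p1 : 1 <= p) (a10 : 0 < a1) (a20 : 0 < a2)
  (k0 : forall d, 0 < d -> 0 <= k d).
Hypothesis compT : compact_embedding T.
Notation ctrl := (controlled T p a1 a2 k).
Context (I : Type) (U : set_system I) (UU : UltraFilter U).
Variables (y : I -> R -> H) (e : I -> R -> R -> R) (B : R).
Hypotheses (ce : forall i, ctrl (y i) (e i))
  (yB : forall i t, 0 <= t -> `|y i t| <= B).

Let B0 : 0 <= B.
Proof.
have [i _] := filter_ex (@filterT _ U _).
exact: le_trans (yB i (lexx 0)).
Qed.

(* A bound of the energy over windows of length at most 1. *)
Let Emax := (B ^+ 2 + (1 + k 1)) / a1.

Lemma energy_le i s t : 0 <= s -> s <= t -> t <= s + 1 -> e i s t <= Emax.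
Proof.
move=> s0 st ts; rewrite ler_pdivlMr// mulrC.
have t0 : 0 <= t by exact: le_trans st.
have := ctrl_norm (ce i) ltr01 s0 st ts.
have : `|y i s| ^+ 2 <= B ^+ 2 by rewrite ler_sqr ?nnegrE ?yB.
have := sqr_ge0 `|y i t|.
have : k 1 * (t - s) <= k 1 by rewrite -[leRHS]mulr1 ler_wpM2l ?k0//; lra.
lra.
Qed.

Section at_time.
Variables (t0 r : R).
Hypotheses (r0 : 0 < r) (rt0 : r <= t0) (r1 : 2 * r <= 1).

Let a := t0 - r.
Let a0 : 0 <= a. Proof. by rewrite subr_ge0. Qed.
(* The limit energy accumulated from [a] on. *)
Let phi t := lim ((fun i => e i a t) @ U).

Lemma cvg_phi t : a <= t -> t <= t0 + r -> (fun i => e i a t) @ U --> phi t.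
Proof.
move=> at_ tr; apply/cvg_ex; have t1 : t <= a + 1 by move: r1 tr; rewrite /a; lra.
have := @ultra_bounded_cvg I U UU R (fun i => e i a t) Emax.
case/(_ _)/cvg_ex => [i|l]; last by exists l.
by rewrite ger0_norm ?(ctrl_ge0 (ce i))// energy_le.
Qed.

Lemma phi_le t : a <= t -> t <= t0 + r -> phi t <= Emax.
Proof.
move=> at_ tr; have t1 : t <= a + 1 by move: r1 tr; rewrite /a; lra.
have pt := cvg_phi at_ tr; rewrite /phi; apply: limr_le; first by apply/cvg_ex; exists (phi t).
by apply: nearW => i; exact: energy_le.
Qed.

Lemma near_energy_le s t d : a <= s -> s <= t -> t <= t0 + r -> 0 < d ->
  \forall i \near U, e i s t <= phi t - phi s + d.
Proof.
move=> as_ st tr d0.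
have /cvgrPdist_le h1 := cvg_phi (le_trans as_ st) tr.
have /cvgrPdist_le h2 := cvg_phi as_ (le_trans st tr).
have d2 : 0 < d / 2 by rewrite divr_gt0.
near=> i.
have : `|phi t - e i a t| <= d / 2 by near: i; exact: h1.
have : `|phi s - e i a s| <= d / 2 by near: i; exact: h2.
rewrite !ler_norml => /andP[? ?] /andP[? ?].
have := ctrl_split (ce i) a0 as_ st; lra.
Unshelve. all: by end_near. Qed.

(** The limit energy is monotone and bounded, so it has a left limit at [t0]:
    pick [s] where it is within [d / 2] of its supremum before [t0]. *)
Lemma left_energy_small d n : 0 < d -> 0 < n -> exists s, [/\ a <= s, t0 - n <= s, s < t0 &
  forall t, s <= t -> t < t0 -> \forall i \near U, e i s t <= d].
Proof.
move=> d0 n0; pose S := [set phi t | t in `[a, t0[%classic].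
have at0 : a < t0 by rewrite /a ltrBlDr ltrDl.
have tr : t0 <= t0 + r by rewrite lerDl ltW.
have supS : has_sup S.
  split; first by exists (phi a), a => //=; rewrite in_itv/= lexx at0.
  exists Emax => x [t /=]; rewrite in_itv/= => /andP[? ?] <-.
  by apply: phi_le => //; apply: le_trans tr; exact: ltW.
have d2 : 0 < d / 2 by rewrite divr_gt0.
have [x [s' /=]] := sup_adherent d2 supS; rewrite in_itv/= => /andP[as' st0] <- phis.
exists (Num.max s' (t0 - n)); split.
- by rewrite le_max as'.
- by rewrite le_max lexx orbT.
- by rewrite gt_max st0 ltrBlDr ltrDl.
move=> t st tt0; have s't : s' <= t by apply: le_trans st; rewrite le_max lexx.
have tr' : t <= t0 + r by apply: le_trans tr; exact: ltW.
have phit : phi t <= sup S.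
  apply: sup_upper_bound => //; exists t => //=; rewrite in_itv/= tt0 andbT.
  exact: le_trans s't.
have := near_energy_le as' s't tr' d2; apply: filterS => i h.
apply: le_trans (ctrl_mono (ce i) (le_trans a0 as') _ st (lexx t)) _.
  by rewrite le_max lexx.
lra.
Qed.

(** Each trajectory passes in the window through a ball of [V] that depends only
    on the window and [d].  That ball is relatively compact in [H], so the values
    at these times, which vary with [i], have a limit. *)
Lemma window_limit s m d : 0 <= s -> s < m -> 0 < d ->
  (\forall i \near U, e i s m <= d) ->
  exists z, forall eps, 0 < eps -> \forall i \near U, exists x v,
    [/\ s <= x, x <= m, embVH T v = y i x, (m - s) * `|v| `^ p <= 2 * d &
        `|y i x - z| <= eps].
Proof.
move=> s0 sm d0 ed.
have ms0 : 0 < m - s by rewrite subr_gt0.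
pose l := 2 * d / (m - s); have l0 : 0 < l by rewrite divr_gt0// mulr_gt0.
pose P i (xv : R * V) := e i s m <= d -> [/\ s <= xv.1, xv.1 <= m,
  embVH T xv.2 = y i xv.1 & `|xv.2| `^ p <= l].
have /choice[xv xvP] : forall i, exists xv, P i xv.
  move=> i; rewrite /P; case: (leP (e i s m) d) => [ei|_]; last by exists (0, 0).
  have : e i s m < l * (m - s).
    by rewrite /l divfK ?gt_eqF//; apply: le_lt_trans ei _; rewrite ltr_pMl// ltr1n.
  by move/(ctrl_point (ce i) s0 sm) => [x [v [? ? ? ?]]]; exists (x, v).
pose Bl := [set v : V | `|v| <= 1 + l].
have Bb : bounded_set Bl.
  exists (1 + l); split; first exact: num_real.
  by move=> x lx v /= vl; apply: le_trans vl (ltW lx).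
have := compT Bb; rewrite precompactE => cB.
have inB : \forall i \near U, closure (embVH T @` Bl) (embVH T (xv i).2).
  apply: filterS ed => i /(xvP i)[_ _ _ vl]; apply: subset_closure.
  exists (xv i).2 => //=; exact: (le_of_powR_le p1 (normr_ge0 _) (ltW l0) vl).
have [z _ xz] := ultra_compact_cvg UU (f := fun i => embVH T (xv i).2) cB inB.
exists z => eps eps0; move/cvgrPdist_le : xz => /(_ _ eps0) xz.
near=> i; exists (xv i).1, (xv i).2.
have [h1 h2 h3 h4] : [/\ s <= (xv i).1, (xv i).1 <= m,
  embVH T (xv i).2 = y i (xv i).1 & `|(xv i).2| `^ p <= l].
  by apply: xvP; near: i.
split => //; first by rewrite mulrC -ler_pdivlMr.
by rewrite -h3 distrC; near: i.
Unshelve. all: by end_near. Qed.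

(** Specializes [ctrl_strong] to the smallness conditions met in both uses. *)
Lemma window_increment i d s x t v : 0 < d -> 0 <= s -> s <= x -> x <= t -> t <= x + 1 ->
  embVH T v = y i x -> k d * (t - x) <= d -> (t - x) * `|v| `^ p <= 8 * d ->
  e i s t <= d -> `|y i t - y i x| ^+ 2 <= (22 + 2 * a2) * d.
Proof.
move=> d0 s0 sx xt tx vx kd vd ed.
have x0 : 0 <= x by exact: le_trans sx.
have := ctrl_strong a10 (ce i) d0 x0 xt tx vx.
have ext : e i x t <= d by apply: le_trans ed; exact: ctrl_mono (ce i) s0 sx xt (lexx _).
have : 2 * a2 * e i x t <= 2 * a2 * d by rewrite ler_pM2l// mulr_gt0.
lra.
Qed.

(* The energy for which [window_increment] gives accuracy [eps / 2]. *)
Let quad eps := (eps / 2) ^+ 2 / (22 + 2 * a2).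

Let quad_den_gt0 : 0 < 22 + 2 * a2. Proof. by rewrite addr_gt0// mulr_gt0. Qed.

Let quad_gt0 eps : 0 < eps -> 0 < quad eps.
Proof. by move=> e0; rewrite /quad divr_gt0// exprn_gt0// divr_gt0. Qed.

Let quadP eps (w w' z : H) : 0 < eps -> `|w - w'| ^+ 2 <= (22 + 2 * a2) * quad eps ->
  `|w' - z| <= eps / 2 -> `|w - z| <= eps.
Proof.
move=> e0; rewrite /quad mulrC divfK ?gt_eqF// ler_sqr ?nnegrE ?divr_ge0 ?(ltW e0)// => h1 h2.
by rewrite -(subrKA w') (splitr eps); apply: le_trans (ler_normD _ _) _; exact: lerD.
Qed.

Let small_time d : 0 < d -> exists2 n, 0 < n & forall h, h <= n -> k d * h <= d.
Proof.
move=> d0; have kd1 : 0 < k d + 1 by rewrite ltr_wpDl ?k0.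
exists (d / (k d + 1)) => [|h hn]; first by rewrite divr_gt0.
apply: (@le_trans _ _ (k d * (d / (k d + 1)))); first by rewrite ler_wpM2l ?k0.
by rewrite mulrCA ler_piMr ?(ltW d0)// ler_pdivrMr// mul1r lerDl.
Qed.

(** A fixed window [s, m] just before [t0] provides the compactness, and the
    energy from [s] to any later time before [t0] is small. *)
Lemma left_limit eps : 0 < eps -> exists z m, [/\ 0 <= m, m < t0 &
  forall t, m <= t -> t < t0 -> \forall i \near U, `|y i t - z| <= eps].
Proof.
move=> eps0; have d0 := quad_gt0 eps0; set d := quad eps in d0.
have [n n0 nP] := small_time d0.
have [s [as_ ns st0 sP]] := left_energy_small d0 n0.
have s0 : 0 <= s by exact: le_trans as_.
pose m := (s + t0) / 2.
have sm : s < m by rewrite /m; lra.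
have mt0 : m < t0 by rewrite /m; lra.
have [z zP] := window_limit s0 sm d0 (sP m (ltW sm) mt0).
exists z, m; split => //; first by apply: le_trans s0 (ltW sm).
move=> t mt tt0; have eps20 : 0 < eps / 2 by rewrite divr_gt0.
have st : s <= t by apply: le_trans mt; exact: ltW.
apply: filterS (filterI (sP t st tt0) (zP _ eps20)) => i [et [x [v [sx xm vx vd xz]]]].
apply: (quadP eps0 _ xz); apply: (window_increment d0 s0 sx) => //.
- exact: le_trans mt.
- by move: as_ sx tt0 r0 r1; rewrite /a; lra.
- exact: vx.
- by apply: nP; lra.
- apply: (@le_trans _ _ (2 * ((m - s) * `|v| `^ p))); last lra.
  rewrite mulrA ler_wpM2r ?powR_ge0// /m; lra.
Qed.

(** Energy spent across [t0] must be paid by a drop of [|y|^2], which is at most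
    [2 |(w, y (t0 - rho))|] for the increment [w].  Before [t0] the trajectories
    are close to a fixed vector of the form [embVH T v], and the pairing of [w]
    with it tends to zero with the length of the window. *)
Lemma no_energy_concentration d : 0 < d -> exists rho, [/\ 0 < rho, rho <= r &
  \forall i \near U, e i (t0 - rho) (t0 + rho) <= d].
Proof.
move=> d0; pose dl := a1 * d / 8.
have dl0 : 0 < dl by rewrite divr_gt0// mulr_gt0.
pose eps := dl / (8 * (B + 1)).
have B1 : 0 < B + 1 by rewrite ltr_wpDl.
have eps0 : 0 < eps by rewrite divr_gt0// mulr_gt0.
have [z [m [m0 mt0 zP]]] := left_limit eps0.
have [v vz] : exists v, `|z - embVH T v| < eps.
  have [] := embVH_dense T (O := ball z eps).
  - by exists z; exact: ballxx.
  - exact: ball_open.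
  - by move=> x [] + [v _ vx]; rewrite -vx -ball_normE => ?; exists v.
pose C := a2 * Emax + (1 + k 1).
have Emax0 : 0 <= Emax by rewrite divr_ge0 ?(ltW a10)// addr_ge0 ?sqr_ge0// addr_ge0 ?k0.
have C0 : 0 < C.
  have k1 : 0 < 1 + k 1 by rewrite ltr_pwDl// k0.
  by rewrite ltr_wpDl// mulr_ge0// ltW.
(* Scaling [v] by [lam] makes the bound [C] negligible: the weak control reads
   [lam * |(w, v)| <= n * |lam v|^p + C], and [n] is chosen after [lam]. *)
pose lam := C / dl; have lam0 : 0 < lam by rewrite divr_gt0.
pose N := `|lam *: v| `^ p.
have N0 : 0 <= N by exact: powR_ge0.
pose n1 := C / (N + 1).
have n10 : 0 < n1 by rewrite divr_gt0// ltr_wpDl.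
have [n2 n20 n2P] := small_time dl0.
pose n := Num.min (Num.min n1 n2) (Num.min (t0 - m) r).
have n0 : 0 < n by rewrite !lt_min n10 n20 r0 subr_gt0 mt0.
have /andP[nn1 nn2] : (n <= n1) && (n <= n2) by rewrite !ge_min !lexx ?orbT.
have /andP[nm nr] : (n <= t0 - m) && (n <= r) by rewrite !ge_min !lexx ?orbT.
pose rho := n / 2.
have rho0 : 0 < rho by rewrite divr_gt0.
have rhoE : rho + rho = n by rewrite /rho -splitr.
exists rho; split => //; first by move: nr n0; rewrite /rho; lra.
have mtau : m <= t0 - rho by lra.
have tau0 : 0 <= t0 - rho by exact: le_trans mtau.
have taut0 : t0 - rho < t0 by rewrite ltrBlDr ltrDl.
have st : t0 - rho <= t0 + rho by lra.
have ts : t0 + rho <= t0 - rho + 1 by move: r1; lra.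
have dE : t0 + rho - (t0 - rho) = n by lra.
apply: filterS (zP _ mtau taut0) => i yz.
have yv : `|y i (t0 - rho) - embVH T v| <= 2 * eps.
  rewrite -(subrKA z); apply: le_trans (ler_normD _ _) _.
  by rewrite mulr_natl mulr2n; apply: lerD => //; exact: ltW.
pose w := y i (t0 + rho) - y i (t0 - rho).
have wB : `|w| <= 2 * B.
  apply: le_trans (ler_normB _ _) _; rewrite mulr_natl mulr2n.
  by apply: lerD; apply: yB => //; exact: le_trans st.
have ipv : `|inner T w (embVH T v)| <= 2 * dl.
  have := ctrl_weak (ce i) (lam *: v) ltr01 tau0 st ts.
  have -> : embVH T (lam *: v) = lam *: embVH T v by exact: linearZ.
  rewrite ipZr normrM (gtr0_norm lam0) dE -/w -/N => h.
  have h1 : n * N <= C.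
    apply: (@le_trans _ _ (n1 * (N + 1))); last by rewrite /n1 divfK// gt_eqF// ltr_wpDl.
    by apply: ler_pM => //; [exact: ltW|rewrite lerDl].
  have h2 : a2 * e i (t0 - rho) (t0 + rho) <= a2 * Emax by rewrite ler_pM2l// energy_le.
  have h3 : k 1 * n <= k 1 by rewrite -[leRHS]mulr1 ler_wpM2l ?k0//; move: r1; lra.
  have : lam * `|inner T w (embVH T v)| <= 2 * C by rewrite /C in h1 *; lra.
  by rewrite -ler_pdivlMl// /lam invf_div mulrCA -mulrA mulVf ?gt_eqF// mulr1.
have := ctrl_norm (ce i) dl0 tau0 st ts; rewrite dE.
have := n2P _ nn2.
have := sqr_ge0 `|w|; rewrite {1}/w (normB_sqr T) -/w.
have : `|inner T w (y i (t0 - rho))| <= 3 * dl.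
  have -> : inner T w (y i (t0 - rho)) =
      inner T w (y i (t0 - rho) - embVH T v) + inner T w (embVH T v).
    by rewrite ipBr subrK.
  apply: le_trans (ler_normD _ _) _; rewrite (_ : 3 * dl = dl + 2 * dl); last by ring.
  apply: lerD => //; apply: le_trans (cauchy_schwarz _ _ _) _.
  apply: (@le_trans _ _ ((2 * B) * (2 * eps))); first exact: ler_pM.
  rewrite /eps [X in _ * X]mulrA [leLHS]mulrA ler_pdivrMr ?mulr_gt0//.
  by rewrite mulrC [leLHS]mulrC; nra.
rewrite ler_norml => /andP[h _] h1 h2 h3.
rewrite -(ler_pM2l a10); apply: (@le_trans _ _ (8 * dl)); last first.
  by rewrite /dl mulrC divfK.
lra.
Qed.

(** With no energy near [t0], a single window reaching across [t0] controls the
    oscillation on both sides. *)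
Lemma equicontinuous_at eps : 0 < eps -> exists z rho, 0 < rho /\
  \forall i \near U, forall t, t0 - rho <= t -> t <= t0 + rho -> `|y i t - z| <= eps.
Proof.
move=> eps0; have d0 := quad_gt0 eps0; set d := quad eps in d0.
have [n n0 nP] := small_time d0.
have [rho' [rho'0 rho'r ed']] := no_energy_concentration d0.
pose rho := Num.min rho' (n / 2).
have rho0 : 0 < rho by rewrite lt_min rho'0 divr_gt0.
have rr : rho <= r by rewrite ge_min rho'r.
have rho'P : rho <= rho' by rewrite ge_min lexx.
have rn : rho <= n / 2 by rewrite ge_min lexx orbT.
have s0 : 0 <= t0 - rho by move: rt0; lra.
have sm : t0 - rho < t0 - rho / 2 by lra.
have ed : \forall i \near U, e i (t0 - rho) (t0 + rho) <= d.
  by apply: filterS ed' => i; apply: le_trans; apply: (ctrl_mono (ce i)); move: rt0; lra.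
have edm : \forall i \near U, e i (t0 - rho) (t0 - rho / 2) <= d.
  by apply: filterS ed => i; apply: le_trans; apply: (ctrl_mono (ce i)); lra.
have [z zP] := window_limit s0 sm d0 edm.
have eps20 : 0 < eps / 2 by rewrite divr_gt0.
exists z, (rho / 2); split; first by rewrite divr_gt0.
apply: filterS (filterI ed (zP _ eps20)) => i [edi [x [v [sx xm vx vd xz]]]] t st tt.
apply: (quadP eps0 _ xz); apply: (window_increment d0 s0 sx) => //.
- exact: le_trans st.
- by move: r1; lra.
- exact: vx.
- by apply: nP; lra.
- apply: (@le_trans _ _ (4 * ((t0 - rho / 2 - (t0 - rho)) * `|v| `^ p))); last lra.
  by rewrite mulrA ler_wpM2r ?powR_ge0//; lra.
- by apply: le_trans edi; apply: (ctrl_mono (ce i)); lra.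
Qed.

End at_time.
End CompactnessAlongUltrafilter.

Section UniformLimit.
Context (R : realType) (V H : completeNormedModType R) (T : evolution_triple V H).
Variables (p a1 a2 : R) (k : R -> R).
Hypotheses (p1 : 1 <= p) (a10 : 0 < a1) (a20 : 0 < a2)
  (k0 : forall d, 0 < d -> 0 <= k d).
Hypothesis compT : compact_embedding T.
Notation ctrl := (controlled T p a1 a2 k).
Context (I : Type) (U : set_system I) (UU : UltraFilter U).
Variables (y : I -> R -> H) (e : I -> R -> R -> R) (B : R).
Hypotheses (ce : forall i, ctrl (y i) (e i))
  (yB : forall i t, 0 <= t -> `|y i t| <= B).

Lemma local_approximation t0 eps : 0 < t0 -> 0 < eps -> exists z rho, 0 < rho /\
  \forall i \near U, forall t, `|t0 - t| < rho -> `|y i t - z| <= eps.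
Proof.
move=> t00 eps0; pose r := Num.min t0 (1 / 2).
have r0 : 0 < r by rewrite lt_min t00 divr_gt0.
have rt0 : r <= t0 by rewrite ge_min lexx.
have r1 : 2 * r <= 1.
  have : r <= 1 / 2 by rewrite ge_min lexx orbT.
  lra.
have [z [rho [rho0 zP]]] :=
  equicontinuous_at p1 a10 a20 k0 compT UU ce yB r0 rt0 r1 eps0.
exists z, rho; split => //; apply: filterS zP => i h t.
by rewrite distrC ltr_distl => /andP[/ltW ? /ltW ?]; exact: h.
Qed.

(** The pointwise limits exist because the values are Cauchy along the
    ultrafilter; the local approximation is transferred to the limit, and the
    covering form of compactness of segments makes it uniform. *)
Lemma ultra_uniform_limit : exists w : R -> H,
  (forall t : R, 0 < t -> w x @[x --> t] --> w t) /\
  forall a b eps, 0 < a -> 0 < eps -> \forall i \near U,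
    forall t, a <= t -> t <= b -> `|y i t - w t| <= eps.
Proof.
pose w t := lim ((fun i => y i t) @ U).
have wE t : 0 < t -> (fun i => y i t) @ U --> w t.
  move=> t0; apply: cauchy_cvg; apply: cauchy_exP => eps eps0.
  have [z [rho [rho0 zP]]] := local_approximation t0 (divr_gt0 eps0 (ltr0Sn _ 1)).
  exists z; apply: filterS zP => i /(_ t); rewrite subrr normr0 => /(_ rho0) h.
  rewrite -ball_normE /= distrC; apply: le_lt_trans h _.
  by rewrite ltr_pdivrMr// ltr_pMr// ltr1n.
have loc t0 eps : 0 < t0 -> 0 < eps -> exists z rho, [/\ 0 < rho,
    forall t, `|t0 - t| < rho -> 0 < t /\ `|w t - z| <= eps &
    \forall i \near U, forall t, `|t0 - t| < rho -> `|y i t - z| <= eps].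
  move=> t00 eps0; have e20 : 0 < eps / 2 by rewrite divr_gt0.
  have [z [rho [rho0 zP]]] := local_approximation t00 e20.
  exists z, (Num.min rho t0); split; first by rewrite lt_min rho0.
    move=> t; rewrite lt_min => /andP[trho tt0].
    have t1 : 0 < t by move: tt0; rewrite distrC ltr_distl subrr => /andP[].
    split => //; have /cvgrPdist_le/(_ _ e20) wt := wE _ t1.
    have [i [h1 h2]] := filter_ex (filterI wt zP).
    rewrite -(subrKA (y i t)) (splitr eps); apply: le_trans (ler_normD _ _) _.
    by apply: lerD => //; exact: h2.
  apply: filterS zP => i h t; rewrite lt_min => /andP[trho _].
  by apply: le_trans (h _ trho) _; rewrite ler_pdivrMr// ler_peMr ?ler1n ?ltW.
exists w; split.
  move=> t0 t00; apply/cvgrPdist_le => eps eps0.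
  have [z [rho [rho0 wz _]]] := loc _ _ t00 (divr_gt0 eps0 (ltr0Sn _ 1)).
  exists rho => //= t trho; rewrite -(subrKA z) (splitr eps).
  apply: le_trans (ler_normD _ _) _; apply: lerD.
    by apply: (wz t0 _).2; rewrite subrr normr0.
  by rewrite distrC; exact: (wz t trho).2.
move=> a b eps apos eps0.
have /compact_near_coveringP cov := @segment_compact R a b.
have : \near U, `[a, b]%classic `<=` (fun t => `|y U t - w t| <= eps).
  apply: (cov I U (fun i t => `|y i t - w t| <= eps)) => t0 /=.
  rewrite in_itv/= => /andP[at0 _].
  have [z [rho [rho0 wz yz]]] := loc _ _ (lt_le_trans apos at0) (divr_gt0 eps0 (ltr0Sn _ 1)).
  exists ([set t | `|t0 - t| < rho],
    [set i | forall t, `|t0 - t| < rho -> `|y i t - z| <= eps / 2]) => /=.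
    by split => //; exists rho.
  move=> [t i] /= [tr h]; rewrite -(subrKA z) (splitr eps).
  apply: le_trans (ler_normD _ _) _; apply: lerD; first exact: h.
  by rewrite distrC; exact: (wz t tr).2.
by apply: filterS => i h t at_ tb; apply: h; rewrite /= in_itv/= at_.
Qed.

End UniformLimit.

(** * The global attractor *)

Section TrajectorySpace.
Context (R : realType) (H : completeNormedModType R) (K : R -> set (R -> H)).
Implicit Types (z y : R -> H).

Lemma Kcup_shift z h : Kcup K z -> 0 <= h -> Kcup K (fun s => z (s + h)).
Proof.
move=> [tau [h' [y [tau0 h0 Ky ->]]]] hp; exists tau, (h' + h), y; split => //.
  by rewrite addr_ge0.
by apply/funext => s; rewrite /Defs.shift; congr (y _); ring.
Qed.

(** [Kplus_approx] and [Kplus_of_approx] replace the topology of uniform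
    convergence on segments by approximation on the segments [0, M]. *)
Lemma Kplus_approx z M eps : Kplus K z -> 0 <= M -> 0 < eps ->
  exists2 y, Kcup K y & forall t, 0 <= t -> t <= M -> `|y t - z t| <= eps.
Proof.
move=> [_ cz] M0 eps0.
have sM : @segments R `[0, M]%classic by exists 0, M.
have [y [Ky yz]] := cz _ (fam_nbhs (z : {family @segments R, R -> H})
  (entourage_ball H (PosNum eps0)) sM).
exists y => // t t0 tM; have := yz t; rewrite /= in_itv/= t0 => /(_ tM).
by rewrite -ball_normE /= distrC => /ltW.
Qed.

Lemma Kplus_of_approx z : {within `[0 : R, +oo[, continuous z} ->
  (forall M eps, 0 <= M -> 0 < eps -> exists2 y, Kcup K y &
    forall t, 0 <= t -> t <= M -> `|y t - z t| <= eps) ->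
  Kplus K z.
Proof.
move=> cz az; split => //.
have /choice[y yP] : forall n : nat, exists y, Kcup K y /\
    forall t, 0 <= t -> t <= n%:R -> `|y t - z t| <= n.+1%:R^-1.
  move=> n; have [//||y Ky yz] := az n%:R n.+1%:R^-1; first by rewrite invr_gt0.
  by exists y.
have yz : {family @segments R, y n @[n --> \oo] --> z}.
  apply/fam_cvgP => _ [t1 [t2 [t10 t12 ->]]] P /uniform_nbhs[E [+ EP]].
  rewrite -entourage_ballE => -[eps /= eps0 ballE].
  have t2n : \forall n \near \oo, t2 <= n%:R by exact: nbhs_infty_ger.
  have neps : \forall n \near \oo, n.+1%:R^-1 < eps by exact: near_infty_natSinv_lt (PosNum eps0).
  apply: filterS (filterI t2n neps) => n [t2n' neps']; apply: EP => t /=.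
  rewrite in_itv/= => /andP[t1t tt2]; apply: ballE => /=.
  rewrite -ball_normE /= distrC; apply: le_lt_trans neps'.
  by apply: (yP n).2; [exact: le_trans t1t|exact: le_trans tt2 t2n'].
move=> P /yz; rewrite nbhs_simpl /= => /filter_ex[n Pn].
by exists (y n); split => //; exact: (yP n).1.
Qed.

End TrajectorySpace.

Section ErealCvg.
Context (R : realType).

Lemma cvge0_at_pinfty (f : R -> \bar R) :
  (forall eps, 0 < eps -> exists t0, forall t, t0 <= t -> (0 <= f t)%E /\ (f t <= eps%:E)%E) ->
  f t @[t --> +oo] --> 0%E.
Proof.
move=> fP A [eps /= eps0 epsA].
have [t0 t0P] := fP (eps / 2) (divr_gt0 eps0 (ltr0Sn _ 1)).
have : \forall t \near +oo, t0 <= t by exact: nbhs_pinfty_ge (num_real _).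
apply: filterS => t /t0P[f0 fe]; rewrite /preimage /=.
move: f0 fe; case: (f t) => // r; rewrite !lee_fin => r0 re.
apply: epsA => /=; rewrite sub0r normrN ger0_norm//; apply: le_lt_trans re _.
by rewrite ltr_pdivrMr// ltr_pMr// ltr1n.
Qed.

Lemma cvge0_small (f : R -> \bar R) eps : f t @[t --> +oo] --> 0%E -> 0 < eps ->
  \forall t \near +oo, (f t < eps%:E)%E.
Proof.
move=> f0 eps0; apply: (f0 [set z | (z < eps%:E)%E]); exists eps => // x /=.
by rewrite sub0r normrN lte_fin; apply: le_lt_trans; exact: ler_norm.
Qed.

End ErealCvg.

Section GlobalAttractor.
Context (R : realType) (V H : completeNormedModType R) (T : evolution_triple V H).
Variables (p a1 a2 : R) (k : R -> R).
Hypotheses (p1 : 1 <= p) (a10 : 0 < a1) (a20 : 0 < a2)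
  (k0 : forall d, 0 < d -> 0 <= k d).
Hypothesis compT : compact_embedding T.
Notation ctrl := (controlled T p a1 a2 k).
Variable K : R -> set (R -> H).
Hypothesis Kctrl : forall z, Kcup K z -> exists e, ctrl z e.
Hypothesis Kne : Kcup K !=set0.
Notation Z := (Kcup K).

Variable R0 : R.
Hypothesis R00 : 0 < R0.
Hypothesis absorb : forall B, 0 <= B -> exists B' T0,
  [/\ 0 <= B', 0 <= T0 & forall z e, ctrl z e -> `|z 0| <= B ->
    (forall t, 0 <= t -> `|z t| <= B') /\ (forall t, T0 <= t -> `|z t| <= R0)].

(** The omega-limit set of the absorbing ball, defined with the united trajectory
    space itself rather than its closure. *)
Definition omega_limit : set H := [set x | forall eps T0, 0 < eps -> exists y t,
  [/\ Z y, `|y 0| <= R0, T0 <= t, 0 <= t & `|y t - x| <= eps]].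

Lemma Kcup_uniform_limit (I : Type) (U : set_system I) (y : I -> R -> H) B :
  UltraFilter U -> 0 <= B -> (forall i, Z (y i)) -> (forall i, `|y i 0| <= B) ->
  exists w : R -> H, (forall t : R, 0 < t -> w x @[x --> t] --> w t) /\
  forall a b eps, 0 < a -> 0 < eps -> \forall i \near U,
    forall t, a <= t -> t <= b -> `|y i t - w t| <= eps.
Proof.
move=> UU B0 yZ yB; have /choice[e ce] : forall i, exists e, ctrl (y i) e.
  by move=> i; exact: Kctrl.
have [B' [T0 [_ _ bd]]] := absorb B0.
apply: (ultra_uniform_limit p1 a10 a20 k0 compT UU ce (B := B')) => i t t0.
by apply: (bd _ _ (ce i) (yB i)).1.
Qed.

(** Trajectories observed later and later converge.  The time origin is moved to
    one unit before [tau i], because the convergence is only uniform away from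
    the initial time. *)
Lemma tail_limit (I : Type) (U : set_system I) (y : I -> R -> H) (tau : I -> R) B :
  UltraFilter U -> 0 <= B -> (forall i, Z (y i)) -> (forall i, `|y i 0| <= B) ->
  (forall M, \forall i \near U, M <= tau i) ->
  exists w, [/\ Kplus K w, forall s, 0 <= s -> omega_limit (w s) &
    forall M eps, 0 < eps -> \forall i \near U, forall s, 0 <= s -> s <= M ->
      `|y i (tau i + s) - w s| <= eps].
Proof.
move=> UU B0 yZ yB tauU.
have [B' [T0 [B'0 T00 bd]]] := absorb B0.
(* Truncated at 0 so that [u i] is a trajectory for every [i]. *)
pose h i := Num.max (tau i - 1) 0.
have h0 i : 0 <= h i by rewrite le_max lexx orbT.
pose u i s := y i (s + h i).
have uZ i : Z (u i) by exact: Kcup_shift.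
have uB i : `|u i 0| <= B'.
  have [e ce] := Kctrl (yZ i).
  by rewrite /u add0r; exact: (bd _ _ ce (yB i)).1.
have [v [cv vP]] := Kcup_uniform_limit UU B'0 uZ uB.
have uE : \forall i \near U, forall s, u i (s + 1) = y i (tau i + s).
  apply: filterS (tauU 1) => i ti s; rewrite /u /h max_l ?subr_ge0//.
  by congr (y i _); ring.
pose w s := v (s + 1).
have wP M eps : 0 < eps -> \forall i \near U, forall s, 0 <= s -> s <= M ->
    `|u i (s + 1) - w s| <= eps.
  move=> eps0; apply: filterS (vP 1 (M + 1) eps ltr01 eps0) => i hi s s0 sM.
  by apply: hi; [rewrite lerDr|rewrite lerD2r].
have wP' M eps : 0 < eps -> \forall i \near U, forall s, 0 <= s -> s <= M ->
    `|y i (tau i + s) - w s| <= eps.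
  move=> eps0; apply: filterS (filterI uE (wP M eps eps0)) => i [ui hi] s s0 sM.
  by rewrite -ui; exact: hi.
exists w; split => //.
- apply: Kplus_of_approx.
    apply: continuous_in_subspaceT => s; rewrite inE/= in_itv/= andbT => s0.
    have s1 : 0 < s + 1 by rewrite ltr_wpDl.
    apply: (@cvg_comp _ _ _ (fun s : R => s + 1) v _ (nbhs (s + 1))); last exact: cv.
    by apply: cvgD; [exact: cvg_id|exact: cvg_cst].
  move=> M eps M0 eps0; have [i hi] := filter_ex (wP M eps eps0).
  by exists (fun s => u i (s + 1)) => //; exact: Kcup_shift.
- move=> s s0 eps T1 eps0.
  (* Restarting at [T0] puts the initial value in the absorbing ball. *)
  have [i [hi ti]] := filter_ex (filterI (wP' s eps eps0) (tauU (Num.max T1 0 + T0))).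
  have [e ce] := Kctrl (yZ i).
  have tT : Num.max T1 0 <= tau i + s - T0.
    by rewrite lerBrDr (le_trans ti)// lerDl.
  exists (fun r => y i (r + T0)), (tau i + s - T0); split.
  + exact: Kcup_shift.
  + by rewrite add0r; apply: (bd _ _ ce (yB i)).2.
  + by apply: le_trans tT; rewrite le_max lexx.
  + by apply: le_trans tT; rewrite le_max lexx orbT.
  + by rewrite subrK; exact: hi.
Qed.

Lemma exists_ultra_infty : exists U : set_system nat, UltraFilter U /\ (\oo `<=` U).
Proof. exact: ultraFilterLemma. Qed.

Lemma omega_limit_nonempty : omega_limit !=set0.
Proof.
have [y0 Zy0] := Kne; have [U [UU oU]] := exists_ultra_infty.
have [//|//||w [_ wA _]] := @tail_limit nat U (fun=> y0) (fun n => n%:R) `|y0 0| UU (normr_ge0 _).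
  by move=> M; apply: oU; exact: nbhs_infty_ger.
by exists (w 0); exact: wA.
Qed.

Lemma omega_limit_closed : closed omega_limit.
Proof.
move=> x cx eps T0 eps0; have e20 : 0 < eps / 2 by rewrite divr_gt0.
have [x' [Ax' xx']] := cx _ (nbhsx_ballx x _ e20).
have [y [t [? ? ? ? yx']]] := Ax' (eps / 2) T0 e20; exists y, t; split => //.
rewrite -(subrKA x') (splitr eps); apply: le_trans (ler_normD _ _) _.
by apply: lerD => //; move: xx'; rewrite -ball_normE /= distrC => /ltW.
Qed.

(** Each point of the set is nearly the value at time 1 of a trajectory with
    bounded initial value; hence every ultrafilter on the set is Cauchy. *)
Lemma omega_limit_compact : compact omega_limit.
Proof.
rewrite compact_ultra => F FU FA.
suff : cauchy_ex F.
  move=> /cauchy_exP /cauchy_cvg Fc; exists (lim F); split => //.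
  by apply: (closed_cvg _ omega_limit_closed FA).
move=> eps eps0; have e30 : 0 < eps / 3 by rewrite divr_gt0.
have /choice[yt ytP] : forall x, exists yt : (R -> H) * R, [/\ Z yt.1, `|yt.1 0| <= R0,
    1 <= yt.2 & omega_limit x -> `|yt.1 yt.2 - x| <= eps / 3].
  have [x1 Ax1] := omega_limit_nonempty => x.
  have [Ax|nAx] := pselect (omega_limit x).
    by have [y [t [? ? ? _ ?]]] := Ax (eps / 3) 1 e30; exists (y, t).
  by have [y [t [? ? ? _ _]]] := Ax1 1 1 ltr01; exists (y, t).
have [B' [T0 [B'0 _ bd]]] := absorb (ltW R00).
pose u x s := (yt x).1 (s + ((yt x).2 - 1)).
have uZ x : Z (u x).
  by have [h1 _ h3 _] := ytP x; apply: Kcup_shift => //; rewrite subr_ge0.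
have uB x : `|u x 0| <= B'.
  have [h1 h2 h3 _] := ytP x; have [e ce] := Kctrl h1.
  by rewrite /u add0r; apply: (bd _ _ ce h2).1; rewrite subr_ge0.
have [w [_ wP]] := Kcup_uniform_limit FU B'0 uZ uB.
exists (w 1); apply: filterS (filterI FA (wP 1 1 _ ltr01 e30)) => x [Ax /(_ 1 (lexx _) (lexx _))].
have [_ _ _ /(_ Ax) h1] := ytP x.
have -> : u x 1 = (yt x).1 (yt x).2 by rewrite /u addrC subrK.
rewrite -ball_normE /= => h2.
rewrite -(subrKA ((yt x).1 (yt x).2)); apply: le_lt_trans (ler_normD _ _) _.
by rewrite distrC; lra.
Qed.

(** Otherwise some trajectories stay [eps] away from the set at arbitrarily large
    times, whereas [tail_limit] provides a limit in the set. *)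
Lemma omega_limit_attracts_Kcup B eps : 0 <= B -> 0 < eps -> exists2 T1, 0 <= T1 &
  forall y t, Z y -> `|y 0| <= B -> T1 <= t -> exists2 x, omega_limit x & `|y t - x| <= eps.
Proof.
move=> B0 eps0; apply: contrapT => nT.
have /choice[yt ytP] : forall n : nat, exists yt : (R -> H) * R, [/\ Z yt.1, `|yt.1 0| <= B,
    n%:R <= yt.2 & forall x, omega_limit x -> eps < `|yt.1 yt.2 - x|].
  move=> n; apply: contrapT => nyt; apply: nT; exists n%:R => // y t Zy yB nt.
  apply: contrapT => nx; apply: nyt; exists (y, t); split => //= x Ax.
  by rewrite ltNge; apply/negP => h; apply: nx; exists x.
have [U [UU oU]] := exists_ultra_infty.
have [n|n|M|w [_ wA wP]] := @tail_limit nat U (fun n => (yt n).1) (fun n => (yt n).2) B UU B0.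
- by have [] := ytP n.
- by have [] := ytP n.
- apply: oU; have : \forall n \near \oo, M <= n%:R by exact: nbhs_infty_ger.
  by apply: filterS => n /le_trans; apply; have [] := ytP n.
have [n /(_ 0 (lexx _) (lexx _))] := filter_ex (wP 0 eps eps0).
rewrite addr0 leNgt => /negP; apply; have [_ _ _] := ytP n; apply; exact: wA.
Qed.

(** Follow trajectories that end near [x] at time [tau], from time [tau - t]. *)
Lemma omega_limit_trajectory x t : omega_limit x -> 0 <= t ->
  exists w, [/\ Kplus K w, omega_limit (w 0) & w t = x].
Proof.
move=> Ax t0.
have /choice[yt ytP] : forall n : nat, exists yt : (R -> H) * R, [/\ Z yt.1, `|yt.1 0| <= R0,
    n%:R + t <= yt.2 & `|yt.1 yt.2 - x| <= n.+1%:R^-1].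
  move=> n; have n0 : 0 < n.+1%:R^-1 :> R by rewrite invr_gt0.
  by have [y [s [? ? ? _ ?]]] := Ax n.+1%:R^-1 (n%:R + t) n0; exists (y, s).
have [U [UU oU]] := exists_ultra_infty.
have [n|n|M|w [Kw wA wP]] := @tail_limit nat U (fun n => (yt n).1) (fun n => (yt n).2 - t) R0 UU (ltW R00).
- by have [] := ytP n.
- by have [] := ytP n.
- apply: oU; have : \forall n \near \oo, M <= n%:R by exact: nbhs_infty_ger.
  by apply: filterS => n /le_trans; apply; rewrite lerBrDr; have [] := ytP n.
exists w; split => //; first exact: wA.
apply/eqP; rewrite -subr_eq0 -normr_le0; apply/ler_addgt0Pl => eps eps0; rewrite addr0.
have e20 : 0 < eps / 2 by rewrite divr_gt0.
have small : \forall n \near U, n.+1%:R^-1 < eps / 2.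
  by apply: oU; exact: near_infty_natSinv_lt (PosNum e20).
have [n [n1 /(_ t t0 (lexx _))]] := filter_ex (filterI small (wP t _ e20)).
have [_ _ _ h1] := ytP n; rewrite subrK => h2.
rewrite -(subrKA ((yt n).1 (yt n).2)) (splitr eps); apply: le_trans (ler_normD _ _) _.
by apply: lerD; [rewrite distrC|exact: le_trans h1 (ltW n1)].
Qed.

Lemma omega_limit_sub : omega_limit `<=` phase_space K.
Proof.
by move=> x Ax; have [w [Kw _ <-]] := omega_limit_trajectory Ax (lexx 0); exists w.
Qed.

Lemma omega_limit_attracts : attracts (phase_space K) (semiflow K) omega_limit.
Proof.
move=> B BX [x0 Bx0] [M [_ MB]].
pose M1 := `|M| + 1; have M10 : 0 <= M1 by rewrite addr_ge0.
have BM x : B x -> `|x| <= M1.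
  by move=> Bx; apply: (MB M1) => //; apply: le_lt_trans (ler_norm _) _; rewrite ltrDl.
apply: cvge0_at_pinfty => eps eps0; have e20 : 0 < eps / 2 by rewrite divr_gt0.
have [T1 T10 T1P] := omega_limit_attracts_Kcup (addr_ge0 M10 ler01) e20.
exists T1 => t T1t; have t0 : 0 <= t by exact: le_trans T1t.
split.
  have [z Kz z0] := BX _ Bx0; have [a Aa] := omega_limit_nonempty.
  apply: (@le_trans _ _ (ereal_inf [set `|z t - d|%:E | d in omega_limit])%E).
    by apply: le_ereal_inf_tmp => _ [d _ <-]; rewrite lee_fin.
  apply: ereal_sup_ubound; exists (z t) => //; exists x0 => //.
  by exists z.
apply: ge_ereal_sup => _ [c [x Bx [z [Kz zx] <-]] <-].
pose d := Num.min 1 (eps / 2); have d0 : 0 < d by rewrite lt_min ltr01.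
have [y Zy yz] := Kplus_approx Kz t0 d0.
have yB : `|y 0| <= M1 + 1.
  rewrite -(subrK (z 0) (y 0)) addrC; apply: le_trans (ler_normD _ _) _; apply: lerD.
    by apply: BM; rewrite zx.
  by apply: le_trans (yz 0 (lexx _) t0) _; rewrite ge_min lexx.
have [a Aa ya] := T1P y t Zy yB T1t.
apply: le_trans (_ : (`|z t - a|%:E <= _)%E).
  by apply: ereal_inf_lbound; exists a.
rewrite lee_fin -(subrKA (y t)) (splitr eps); apply: le_trans (ler_normD _ _) _.
apply: lerD => //; rewrite distrC; apply: le_trans (yz t t0 (lexx _)) _.
by rewrite ge_min lexx orbT.
Qed.

(** By negative semi-invariance the set is contained in its own image at any
    later time, and this image is attracted by [C]. *)
Lemma omega_limit_minimal C : closed_attracting (phase_space K) (semiflow K) C -> omega_limit `<=` C.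
Proof.
move=> [CX Cne Cc Catt] x Ax.
have Ab : bounded_set omega_limit by apply: compact_bounded; exact: omega_limit_compact.
have ACt := Catt omega_limit omega_limit_sub omega_limit_nonempty Ab.
have xX : phase_space K x by exact: omega_limit_sub.
suff xC : closure C x.
  move: Cc => /closed_subspaceP[C' cC' CE].
  have CC' : C `<=` C'.
    move=> c Cx; have : (C `&` phase_space K) c by split => //; exact: CX.
    by rewrite -CE => -[].
  suff : (C `&` phase_space K) x by case.
  by rewrite -CE; split => //; apply: cC'; exact: closureS CC' _ xC.
move=> N /nbhs_ballP[eps /= eps0 epsN].
have pos : \forall t \near +oo, 0 <= t :> R by exact: nbhs_pinfty_ge (num_real _).
have [t [t0 dt]] := filter_ex (filterI pos (cvge0_small ACt eps0)).
have [w [Kw w0 wt]] := omega_limit_trajectory Ax t0.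
have : (ereal_inf [set `|x - d|%:E | d in C] < eps%:E)%E.
  apply: le_lt_trans dt; apply: ereal_sup_ubound; exists x => //.
  by exists (w 0) => //; exists w.
move=> /ereal_inf_lt[_ [d Cd <-]]; rewrite lte_fin => xd.
by exists d; split => //; apply: epsN; rewrite -ball_normE.
Qed.

Lemma omega_limit_global_attractor : global_attractor (phase_space K) (semiflow K) omega_limit.
Proof.
split.
- exact: omega_limit_sub.
- exact: omega_limit_attracts.
- move=> t t0 x /omega_limit_trajectory/(_ t0)[w [Kw Aw wt]].
  by exists (w 0) => //; exists w.
- split; last exact: omega_limit_minimal.
  split; [exact: omega_limit_sub|exact: omega_limit_nonempty| |exact: omega_limit_attracts].
  by apply/closed_subspaceP; exists omega_limit => //; exact: omega_limit_closed.
Qed.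

End GlobalAttractor.

Theorem theorem2p1 (R : realType) (p q : R) (V H : completeNormedModType R)
    (T : evolution_triple V H) (K : R -> set (R -> H))
    (hp : 2 <= p) (hq : 1 < q) (hpq : p^-1 + q^-1 = 1)
    (compT : compact_embedding T)
    (KW : forall tau, 0 <= tau -> K tau `<=` Wloc T p q tau)
    (K0 : exists2 tau0, 0 <= tau0 & K tau0 !=set0)
    (A1 : condA1 T p K) (A2 : condA2 T p q K) :
  exists A : set H, compact A /\ global_attractor (phase_space K) (semiflow K) A.
Proof.
have p0 : 0 < p by lra.
have p1 : 1 <= p by lra.
have q0 : 0 < q by exact: lt_trans hq.
have [a1 [a2 [k [a10 a20 k0 ctrl]]]] := Kcup_controlled p0 q0 hpq KW A1 A2.
have [R0 R00 absorb] := norm_bounds T a2 p1 a10 k0.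
have Kne : Kcup K !=set0.
  have [tau0 tau00 [y Ky]] := K0.
  by exists (Defs.shift 0 (fun s => y (s + tau0))), tau0, 0, y.
exists (omega_limit K R0); split.
  exact: (omega_limit_compact p1 a10 a20 k0 compT ctrl Kne R00 absorb).
exact: (omega_limit_global_attractor p1 a10 a20 k0 compT ctrl Kne R00 absorb).
Qed.
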